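(* Let $a,b,p,q,n$ be positive integers with $n = pa = qb$ and $2 \le p < q$. If the uniform passport $[a^{p}, b^{q}, n]$ has genus at least $2$ (i.e. $g = \frac{n-(p+q+1)}{2}+1$ is an integer with $g\ge 2$), then there exists a dessin d'enfant with passport $[a^{p}, b^{q}, n]$ whose automorphism group is trivial. The same statement holds for any passport obtained by permuting the three entries $a^{p}$, $b^{q}$, and $n$.
   Context: A dessin d'enfant (dessin) is a connected finite bipartite graph (vertices coloured black and white, each edge joining a black to a white vertex) embedded as a map in a connected compact oriented surface without boundary. Let $E$ be its edge set, $|E|=n$. Let $x,y\in \mathrm{Sym}(E)$ be the permutations sending each edge to the next edge, counterclockwise, around its black vertex and its white vertex respectively, and let $z=(xy)^{-1}$. The monodromy group is $G=\langle x,y\rangle$, which is transitive on $E$; conversely every pair $(x,y)$ of permutations of a finite set generating a transitive group arises from a dessin. The passport of the dessin is the triple $[\lambda_0,\lambda_1,\lambda_\infty]$ of partitions of $n$ given by the valencies of black vertices, white vertices and faces, i.e. the cycle types of $x,y,z$. The automorphism group of the dessin is the centralizer of $G$ in $\mathrm{Sym}(E)$, i.e. $\{c\in \mathrm{Sym}(E) : cx=xc,\ cy=yc\}$; it is trivial if it consists of the identity only. A passport is uniform if it has the form $[a^{p},b^{q},c^{r}]$ with $n=pa=qb=rc$, where $a^{p}$ denotes the partition of $n$ into $p$ parts all equal to $a$, and $n$ alone denotes the partition with the single part $n$. Its genus is $g=\frac{n-(p+q+r)}{2}+1$; for $[a^p,b^q,n]$ one has $r=1$. Saying that a passport has genus at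 least $2$ means that this number is an integer and is $\ge 2$. *)

(* Defs.v *)
From HB Require Import structures.
From mathcomp Require Import all_boot all_order all_fingroup all_algebra.
Set Implicit Arguments.
Unset Strict Implicit.
Unset Printing Implicit Defensive.

(* A dessin d'enfant is encoded by its set of edges and the two rotations of
   the edges around the black and the white vertices. Connectedness of the
   bipartite graph is transitivity of the monodromy group; mathcomp's
   [transitive _, on S | _] also forces S to be nonempty. *)
Record dessin := Dessin {
  edge : finType;
  black_rot : {perm edge};
  white_rot : {perm edge};
  dessin_connected :
    [transitive <<[set black_rot; white_rot]>>, on [set: edge] | 'P]%g
}.

Definition face_rot (D : dessin) : {perm edge D} :=
  ((black_rot D * white_rot D)^-1)%g.

Definition monodromy (D : dessin) : {group {perm edge D}} :=
  <<[set black_rot D; white_rot D]>>%G.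

Definition automorphism_group (D : dessin) : {group {perm edge D}} :=
  'C(monodromy D)%G.

(* Partitions are sequences of parts in nonincreasing order, so the partition
   a^p is [nseq p a]. Fixed points count as cycles of length 1. *)
Definition cycle_type (T : finType) (s : {perm T}) : seq nat :=
  sort geq [seq #|C| | C : {set T} in porbits s].

Definition passport := (3.-tuple (seq nat))%type.

Definition passport_of (D : dessin) : passport :=
  [tuple cycle_type (black_rot D); cycle_type (white_rot D);
         cycle_type (face_rot D)].

Definition uniform_passport (a p b q c r : nat) : passport :=
  [tuple nseq p a; nseq q b; nseq r c].

(* All three entries of a passport are partitions of the same number n, which
   is recovered here as the sum of the first one. *)
Definition genus (P : passport) : rat :=
  let n := sumn (tnth P ord0) in
  let parts := (\sum_(l <- P) size l)%N in
  ((n%:R - parts%:R) / 2%:R + 1)%R.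

(* Main.v *)
Require Import Defs.
From HB Require Import structures.
From mathcomp Require Import all_boot all_order all_fingroup all_algebra.
From mathcomp Require Import zify ring.
Set Implicit Arguments.
Unset Strict Implicit.
Unset Printing Implicit Defensive.

(* The face permutation c = x y is an n-cycle and every automorphism commutes
   with it, so an automorphism that fixes one edge is trivial. Put
   k = gcd(p, q), p = k p0, q = k q0 and N = n / k. Integrality of the genus
   makes k and N + p0 + q0 odd, and then the Chinese remainder theorem provides
   s + w = 1 in Z/N with s of additive order a and w of additive order b: the
   translations by s and w form a regular dessin with passport
   [a^p0, b^q0, N].

   For k = 1, multiply one rotation by a 3-cycle on three edges of a vertex that
   occur in the same cyclic order around the vertex and around the face. The
   cycle types do not change, but the two rotations now fail to commute at only
   six edges, and an automorphism has to permute these.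

   For k > 1, take a k-fold cover of the regular dessin that is unramified over
   the vertices and totally ramified over the centre of the face, with
   monodromy generated by v + 1 and 2 v on Z/k (their commutator is a k-cycle
   because k is odd). An automorphism translates the base Z/N and intertwines
   the holonomies along the translation, which forces it to be trivial, except
   that for b = 2 the half turn of the base lifts when it inverts both
   generators, i.e. when k = 3. In that case a third generator is added, which
   needs q0 > 3. Four small passports remain and are given by tables. *)

(** * Uniform cycle types and asymmetric pairs of rotations *)

Section UniformCycles.
Local Open Scope group_scope.

Definition uniform_cycles (T : finType) (s : {perm T}) (a : nat) :=
  forall e, #|porbit s e| = a.

Definition asymmetric (T : finType) (x y : {perm T}) :=
  forall u : {perm T}, commute u x -> commute u y -> u = 1.

(** The last length is imposed on [x * y] instead of the face rotation [(x * y)^-1]: a permutation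
    and its inverse have the same cycles. *)
Definition asymmetric_triple (n a b c : nat) : Prop :=
  exists (T : finType) (x y : {perm T}),
    [/\ #|T| = n, [transitive <<[set x; y]>>, on [set: T] | 'P],
        [/\ uniform_cycles x a, uniform_cycles y b & uniform_cycles (x * y) c]
      & asymmetric x y].

Lemma uniform_cyclesP (T : finType) (s : {perm T}) a :
  0 < a -> (forall e i, i < a -> ((s ^+ i) e == e) = (i == 0)) ->
  (forall e, (s ^+ a) e = e) -> uniform_cycles s a.
Proof.
move=> a_gt0 s_min sa e.
have po_gt0 : 0 < #|porbit s e| by rewrite lt0n card_porbit_neq0.
have po_le : #|porbit s e| <= a.
  rewrite leqNgt; apply/negP=> lt_a.
  have := uniq_traject_porbit s e.
  move/(nth_uniq e)=> /(_ 0 a); rewrite size_traject => /(_ po_gt0 lt_a).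
  by rewrite !nth_traject //= -permX sa eqxx; case: (a) a_gt0.
apply/eqP; rewrite eqn_leq po_le leqNgt; apply/negP=> po_lt.
by have := s_min e _ po_lt; rewrite permX iter_porbit eqxx => /esym/eqP po0; rewrite po0 in po_gt0.
Qed.

Lemma uniform_cycles_expg (T : finType) (s : {perm T}) a :
  0 < a -> (forall e i, ((s ^+ i) e == e) = (a %| i)) -> uniform_cycles s a.
Proof.
move=> a_gt0 sE; apply: uniform_cyclesP => // e; last by apply/eqP; rewrite sE.
by move=> i lt_ia; rewrite sE; case: i lt_ia => [|i] lt_ia; rewrite ?dvdn0 // gtnNdvd.
Qed.

Lemma uniform_cycles_full (T : finType) (s : {perm T}) e0 :
  (forall e, e \in porbit s e0) -> uniform_cycles s #|T|.
Proof.
move=> s_full e; have := s_full e; rewrite -eq_porbit_mem => /eqP->.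
by apply: eq_card => e'; rewrite s_full.
Qed.

Lemma card_uniform_cycles (T : finType) (s : {perm T}) a :
  uniform_cycles s a -> #|T| = (#|porbits s| * a)%N.
Proof.
move=> s_a; rewrite -[LHS]sum1_card.
rewrite (partition_big (porbit s) (fun C => C \in porbits s)) /=; last first.
  by move=> e _; apply: imset_f.
rewrite -sum_nat_const; apply: eq_bigr => _ /imsetP[e _ ->].
rewrite -(s_a e) -sum1_card; apply: eq_bigl => e'.
by rewrite -eq_porbit_mem.
Qed.

Lemma cycle_type_uniform (T : finType) (s : {perm T}) a p :
  0 < a -> #|T| = (p * a)%N -> uniform_cycles s a -> cycle_type s = nseq p a.
Proof.
move=> a_gt0 cardT s_a; have := card_uniform_cycles s_a.
rewrite cardT => /eqP; rewrite eqn_pmul2r // => /eqP->.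
rewrite /cycle_type.
have all_a : all (pred1 a) (sort geq [seq #|C| | C : {set T} in porbits s]).
  rewrite all_sort; apply/allP => _ /mapP[C + ->].
  by rewrite mem_enum => /imsetP[e _ ->]; rewrite /= s_a.
by rewrite (all_pred1P _ _ all_a) size_sort size_map cardE.
Qed.

Lemma uniform_cyclesJ (T : finType) (s h : {perm T}) a :
  uniform_cycles s a -> uniform_cycles (s ^ h) a.
Proof.
move=> s_a e; rewrite -(s_a (h^-1 e)) -[RHS](card_imset _ (@perm_inj _ h)).
apply: eq_card => e'; apply/porbitP/imsetP.
  case=> i ->; exists ((s ^+ i) (h^-1 e)); first exact: mem_porbit.
  by rewrite -conjXg conjgE !permM.
case=> _ /porbitP[i ->] ->; exists i.
by rewrite -conjXg conjgE !permM.
Qed.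

Lemma uniform_cyclesV (T : finType) (s : {perm T}) a :
  uniform_cycles s a -> uniform_cycles s^-1 a.
Proof. by move=> s_a e; rewrite porbitV. Qed.

(** Exchanging the colours replaces [x * y] by its conjugate under [x]. *)
Lemma asymmetric_triple_swap n a b c :
  asymmetric_triple n a b c -> asymmetric_triple n b a c.
Proof.
move=> [T [x [y [cardT tr [xa yb zc] asym]]]]; exists T, y, x; split=> //.
- by rewrite setUC.
- split=> //; have -> : y * x = (x * y) ^ x by rewrite conjgE !mulgA mulVg mul1g.
  exact: uniform_cyclesJ.
- by move=> u uy ux; apply: asym.
Qed.

(** [x] and [y] generate the same group as [y] and [(x * y)^-1], and the product of the last two is
    [x^-1]. *)
Lemma asymmetric_triple_rot n a b c :
  asymmetric_triple n a b c -> asymmetric_triple n b c a.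
Proof.
move=> [T [x [y [cardT tr [xa yb zc] asym]]]]; exists T, y, (x * y)^-1; split=> //.
- suff -> : <<[set y; (x * y)^-1]>> = <<[set x; y]>> by [].
  have xE : x = ((x * y)^-1)^-1 * y^-1 by rewrite invgK mulgK.
  have [xG yG] : x \in <<[set x; y]>> /\ y \in <<[set x; y]>>.
    by split; apply: mem_gen; rewrite !inE eqxx ?orbT.
  have [yH zH] : y \in <<[set y; (x * y)^-1]>> /\ (x * y)^-1 \in <<[set y; (x * y)^-1]>>.
    by split; apply: mem_gen; rewrite !inE eqxx ?orbT.
  apply/eqP; rewrite eqEsubset !gen_subG !subUset !sub1set yG yH /= andbT.
  apply/andP; split; first by rewrite groupV; apply: groupM.
  by rewrite [X in X \in _]xE; apply: groupM; rewrite groupV.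
- split=> //; first exact: uniform_cyclesV.
  have -> : y * (x * y)^-1 = x^-1 by rewrite invMg mulgA mulgV mul1g.
  exact: uniform_cyclesV.
- move=> u uy uz; apply: asym => //.
  have -> : x = ((x * y)^-1)^-1 * y^-1 by rewrite invgK mulgK.
  by apply: commuteM; apply: commuteV => //; apply: commuteV.
Qed.

Lemma asymmetric_triple_dessin n a b c p q r :
  0 < n -> n = (p * a)%N -> n = (q * b)%N -> n = (r * c)%N ->
  asymmetric_triple n a b c ->
  exists D : dessin,
    passport_of D = uniform_passport a p b q c r /\ automorphism_group D = 1%G.
Proof.
move=> n_gt0 npa nqb nrc [T [x [y [cardT tr [xa yb zc] asym]]]].
have a_gt0 : 0 < a by case: (a) npa n_gt0; rewrite ?muln0 // => ->.
have b_gt0 : 0 < b by case: (b) nqb n_gt0; rewrite ?muln0 // => ->.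
have c_gt0 : 0 < c by case: (c) nrc n_gt0; rewrite ?muln0 // => ->.
exists (Dessin tr); split.
  apply: val_inj; rewrite /= /face_rot /=.
  rewrite (cycle_type_uniform (p := p) a_gt0 _ xa) ?cardT //.
  rewrite (cycle_type_uniform (p := q) b_gt0 _ yb) ?cardT //.
  by rewrite (cycle_type_uniform (p := r) c_gt0 _ (uniform_cyclesV zc)) ?cardT.
apply: val_inj; rewrite /= cent_gen; apply/trivgP/subsetP => u /centP cu.
by rewrite inE; apply/eqP/asym; apply: cu; rewrite !inE ?eqxx ?orbT.
Qed.

Lemma asymmetric_triple_of_cycle (T : finType) (x y : {perm T}) a b e0 :
  uniform_cycles x a -> uniform_cycles y b ->
  (forall e, e \in porbit (x * y) e0) -> asymmetric x y ->
  asymmetric_triple #|T| a b #|T|.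
Proof.
move=> xa yb full asym; exists T, x, y; split=> //; last first.
  by split=> //; apply: uniform_cycles_full full.
apply/imsetP; exists e0 => //; apply/esym/setP => e; rewrite inE.
have /porbitP[i ->] := full e.
apply/orbitP; exists ((x * y) ^+ i) => //.
by apply: groupX; apply: groupM; apply: mem_gen; rewrite !inE eqxx ?orbT.
Qed.

(* A symmetry commutes with the cyclic permutation x * y, so it is determined
   by the image of a single edge. *)
Lemma commute_cycle_fix (T : finType) (x y u : {perm T}) e0 e1 :
  (forall e, e \in porbit (x * y) e0) -> commute u x -> commute u y ->
  u e1 = e1 -> u = 1.
Proof.
move=> full ux uy ue1; apply/permP => e; rewrite perm1.
have : e \in porbit (x * y) e1.
  by have := full e1; rewrite -eq_porbit_mem => /eqP->.
case/porbitP => i ->; have := commuteX i (commuteM ux uy) => cu.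
by rewrite -permM -cu permM ue1.
Qed.
End UniformCycles.

(** * The rotations of the regular dessin *)

(** The values of t found for the single primes are glued by the Chinese remainder theorem; the
    induction splits off the part of m at its least prime divisor. *)
Lemma exists_coprime_value (f : nat -> nat) m :
  (forall d t t', t = t' %[mod d] -> f t = f t' %[mod d]) ->
  0 < m -> (forall l, prime l -> l %| m -> exists t, ~~ (l %| f t)) ->
  exists t, coprime (f t) m.
Proof.
move=> f_mod; have [k] := ubnP m; elim: k m => // k IHk m ltmk m_gt0 fP.
have [m_le1 | m_gt1] := leqP m 1.
  by exists 0; rewrite (_ : m = 1) ?coprimen1 //; lia.
set l := pdiv m; have l_pr : prime l by apply: pdiv_prime.
have l_dvd : l %| m by apply: pdiv_dvd.
have co_l : coprime m`_l m`_l^' by apply: coprime_partC.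
have mE : (m`_l * m`_l^')%N = m by apply: partnC.
have m'_gt0 : 0 < m`_l^' by apply: part_gt0.
have ml_gt1 : 1 < m`_l by rewrite p_part_gt1 mem_primes l_pr m_gt0 l_dvd.
have [|//||t' co_t'] := IHk m`_l^'.
  by rewrite -ltnS; apply: leq_trans ltmk; rewrite ltnS -{2}mE ltn_Pmull.
  by move=> l' l'_pr l'_m; apply: fP => //; rewrite -mE dvdn_mull.
have [tl tlP] := fP l l_pr l_dvd.
exists (chinese m`_l m`_l^' tl t'); rewrite -[X in coprime _ X]mE coprimeMr; apply/andP; split.
  rewrite [X in coprime _ X]p_part coprimeXr // coprime_sym prime_coprime //.
  have l_ml : l %| m`_l by rewrite p_part -[X in X %| _]expn1 dvdn_exp2l // logn_gt0 mem_primes l_pr m_gt0.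
  have chinese_l : chinese m`_l m`_l^' tl t' = tl %[mod l].
    by rewrite -(modn_dvdm (chinese _ _ _ _) l_ml) chinese_modl // modn_dvdm.
  by rewrite /dvdn (f_mod l _ _ chinese_l).
by rewrite -coprime_modl (f_mod _ _ t') ?coprime_modl // chinese_modr.
Qed.

(** Modulo a prime l that divides neither c nor d, each form vanishes for one class of t, so one of
    0, 1, 2 is free when l > 2. If l divides c or d, that form is a nonzero constant and the other
    one spares 0 or 1; the parity hypothesis puts l = 2 in this case. *)
Lemma exists_common_coprime m c d u v :
  0 < m -> coprime c d -> coprime u c -> coprime v d ->
  (2 %| m -> (2 %| c) || (2 %| d)) ->
  exists t, coprime (u + c * t) m && coprime (v + d * t) m.
Proof.
move=> m_gt0 co_cd co_uc co_vd m2.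
suff [t] : exists t, coprime ((u + c * t) * (v + d * t)) m.
  by rewrite coprimeMl; exists t.
apply: exists_coprime_value => // [e t t' tt' | l l_pr l_m].
  have tt'M x y : x + y * t = x + y * t' %[mod e].
    by rewrite -modnDmr -modnMmr tt' modnMmr modnDmr.
  by rewrite -modnMml -modnMmr !tt'M modnMml modnMmr.
have ndvd2 x y : coprime x y -> l %| x -> l %| y = false.
  move=> co_xy lx; apply/negP => ly; have : l %| gcdn x y by rewrite dvdn_gcd lx.
  by rewrite (eqP co_xy) dvdn1 => /eqP l1; rewrite l1 in l_pr.
have [lc | lc] := boolP (l %| c).
  have ld := ndvd2 _ _ co_cd lc.
  have lu : l %| u = false by apply: ndvd2 lc; rewrite coprime_sym.
  have [lv|lv] := boolP (l %| v); last by exists 0; rewrite !muln0 !addn0 Euclid_dvdM // lu (negPf lv).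
  exists 1; rewrite !muln1 Euclid_dvdM // dvdn_addl // lu /=.
  by rewrite dvdn_addr // ld.
have [ld | ld] := boolP (l %| d).
  have lv : l %| v = false by apply: ndvd2 ld; rewrite coprime_sym.
  have [lu|lu] := boolP (l %| u); last by exists 0; rewrite !muln0 !addn0 Euclid_dvdM // lv (negPf lu).
  exists 1; rewrite !muln1 Euclid_dvdM // orbC dvdn_addl // lv /=.
  by rewrite dvdn_addr.
have l2 : l %| 2 = false.
  apply/negP => l_2; have l_le2 : l <= 2 by apply: dvdn_leq l_2.
  have l_gt1 := prime_gt1 l_pr.
  have l2 : l = 2 by lia.
  by move: m2; rewrite -l2 (negPf lc) (negPf ld) => /(_ l_m).
have lin x y t i : 0 < i <= 2 -> ~~ (l %| y) -> l %| x + y * t -> l %| x + y * (t + i) = false.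
  move=> i12 ly lxt; rewrite mulnDr addnA dvdn_addr // Euclid_dvdM // (negPf ly) /=.
  by case/andP: i12; case: i => [|[|[|]]] //= _ _; rewrite dvdn1; apply/eqP => l1; rewrite l1 in l_pr.
have [n0|] := boolP (l %| (u + c * 0) * (v + d * 0)); last by exists 0.
have [n1|] := boolP (l %| (u + c * 1) * (v + d * 1)); last by exists 1.
exists 2; rewrite Euclid_dvdM //; move: n0 n1; rewrite !Euclid_dvdM //.
case/orP => h0; case/orP => h1.
- by rewrite (lin u c 0 1) in h1.
- by rewrite (lin u c 0 2) // (lin v d 1 1).
- by rewrite (lin u c 1 1) // (lin v d 0 2).
- by rewrite (lin v d 0 1) in h1.
Qed.

(** Bezout gives [u * p = v * q + 1], hence the pairs p (u + q t), q (v + p t) with difference 1.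
    The parameter t is chosen to make both cofactors prime to N / (p q). *)
Lemma exists_rotations N p q :
  0 < N -> p %| N -> q %| N -> coprime p q -> odd (N + p + q) ->
  exists s w, [/\ gcdn s N = p, gcdn w N = q & s + w = 1 %[mod N]].
Proof.
move=> N_gt0 pN qN co_pq odd_Npq.
have p_gt0 : 0 < p by apply: dvdn_gt0 pN.
have q_gt0 : 0 < q by apply: dvdn_gt0 qN.
have /dvdnP[m NE] : p * q %| N by rewrite Gauss_dvd // pN qN.
have m_gt0 : 0 < m by case: (m) NE N_gt0 => // ->.
case: (egcdnP q p_gt0) => u v; rewrite (eqP co_pq) => uv _.
have co_up : coprime u q.
  have : coprime (u * p) q by rewrite uv /coprime gcdnC gcdnMDl gcdn1.
  by rewrite coprimeMl => /andP[].
have co_vq : coprime v p.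
  have : coprime (u * p) v by rewrite uv mulnC /coprime gcdnC gcdnMDl gcdn1.
  by rewrite coprimeMl coprime_sym => /andP[_]; rewrite coprime_sym.
have [||t /andP[co_u co_v]] := @exists_common_coprime m q p u v m_gt0 _ co_up co_vq.
- by rewrite coprime_sym.
(* If N / (p q) is even then so is N, and the parity hypothesis makes p or q even. *)
- move=> /dvdnP[m' mE]; move: odd_Npq; rewrite NE mE !oddD !oddM /= andbF /=.
  by rewrite !dvdn2; do 2 case: odd.
pose s := p * (u + q * t); pose r := q * (v + p * t).
have sE : s = r.+1 by rewrite /s /r; nia.
(* [N.-1 * r] is - r modulo N. *)
exists s, (N.-1 * r); split.
- rewrite /s NE (_ : m * (p * q) = p * (q * m)); last by nia.
  rewrite -muln_gcdr (_ : gcdn _ _ = 1) ?muln1 //; apply/eqP.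
  by rewrite -/(coprime _ _) coprimeMr co_u andbT /coprime gcdnC addnC mulnC gcdnMDl gcdnC.
- rewrite gcdnC Gauss_gcdr ?coprimenP //.
  rewrite gcdnC /r NE (_ : m * (p * q) = q * (p * m)); last by nia.
  rewrite -muln_gcdr (_ : gcdn _ _ = 1) ?muln1 //; apply/eqP.
  by rewrite -/(coprime _ _) coprimeMr co_v andbT /coprime gcdnC addnC mulnC gcdnMDl gcdnC.
- have -> : s + N.-1 * r = r * N + 1 by rewrite sE; nia.
  by rewrite modnMDl.
Qed.

(** * Reordering three arcs of a cycle *)

Section ThreeCycles.
Local Open Scope group_scope.

Lemma porbit_expg_inj (T : finType) (s : {perm T}) e :
  {in gtn #|porbit s e| &, injective (fun i => (s ^+ i) e)}.
Proof.
move=> i j; rewrite !inE => i_lt j_lt; rewrite !permX => eq_ij; apply/eqP.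
rewrite -(nth_uniq e _ _ (uniq_traject_porbit s e)) ?size_traject //.
by rewrite !nth_traject // eq_ij.
Qed.

Lemma sub_porbit (T : finType) (s t : {perm T}) :
  (forall e, t e \in porbit s e) -> forall e, porbit t e \subset porbit s e.
Proof.
move=> ts e; apply/subsetP => _ /porbitP[i ->].
elim: i => [|i IHi]; first by rewrite perm1 porbit_id.
rewrite expgSr permM; move: IHi; rewrite -!eq_porbit_mem => /eqP <-.
by rewrite eq_porbit_mem.
Qed.

Definition cycle3 (T : finType) (e0 e1 e2 : T) : {perm T} :=
  tperm e0 e1 * tperm e0 e2.

Lemma cycle3E (T : finType) (e0 e1 e2 : T) :
  e0 != e1 -> e0 != e2 -> e1 != e2 ->
  [/\ cycle3 e0 e1 e2 e0 = e1, cycle3 e0 e1 e2 e1 = e2,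
      cycle3 e0 e1 e2 e2 = e0
    & forall e, e \notin [:: e0; e1; e2] -> cycle3 e0 e1 e2 e = e].
Proof.
move=> n01 n02 n12; rewrite /cycle3; split.
- by rewrite permM tpermL tpermD // eq_sym.
- by rewrite permM tpermR tpermL.
- by rewrite permM (tpermD n02 n12) tpermR.
- move=> e; rewrite !inE !negb_or => /and3P[n0 n1 n2].
  by rewrite permM !tpermD // eq_sym.
Qed.

(* Multiplying a cycle by a 3-cycle on elements that it visits in the order
   e0, e1, e2 permutes the three arcs of the cycle between them. *)
Lemma porbit_cycle3 (T : finType) (c : {perm T}) e0 u v :
  0 < u -> u < v -> v < #|porbit c e0| ->
  porbit (cycle3 e0 ((c ^+ u) e0) ((c ^+ v) e0) * c) =1 porbit c.
Proof.
move=> u_gt0 ltuv ltvL; set L := #|porbit c e0| in ltvL.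
set e1 := (c ^+ u) e0; set e2 := (c ^+ v) e0; set t := cycle3 _ _ _.
have c_neq i j : i < L -> j < L -> i != j -> (c ^+ i) e0 != (c ^+ j) e0.
  by move=> iL jL; apply: contraNneq => /porbit_expg_inj ->.
have c_neq0 i : i < L -> i != 0%N -> (c ^+ i) e0 != e0.
  by move=> iL i0; have := c_neq i 0%N iL _ i0; rewrite expg0 perm1; apply; lia.
have n01 : e0 != e1 by rewrite eq_sym c_neq0 //; lia.
have n02 : e0 != e2 by rewrite eq_sym c_neq0 //; lia.
have n12 : e1 != e2 by rewrite c_neq //; lia.
have [t0 t1 t2 tD] := cycle3E n01 n02 n12.
(* The arcs of c are ]0, u], ]u, v] and ]v, L], where L is e0 again. The new cycle leaves e0 and
   runs through ]u, v], then ]0, u], then ]v, L]; inside an arc both permutations agree. *)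
pose O i := porbit (t * c) ((c ^+ i) e0).
have OS e e' : (t * c) e = e' -> porbit (t * c) e = porbit (t * c) e'.
  by move=> <-; rewrite -(porbit_perm (t * c) 1 e) expg1.
have O_seg l h : l <= h -> (forall i, l <= i < h -> [&& i < L, i != 0%N, i != u & i != v]) -> O l = O h.
  move=> le_lh; elim: h le_lh => [|h IHh]; first by rewrite leqn0 => /eqP->.
  rewrite leq_eqVlt => /orP[/eqP-> //|]; rewrite ltnS => le_lh iP.
  rewrite IHh // => [|i /andP[li ih]]; last by apply: iP; rewrite li ltnW.
  have /and4P[hL h0 hu hv] : [&& h < L, h != 0%N, h != u & h != v] by apply: iP; rewrite le_lh /=.
  apply: OS; rewrite permM tD -?permM -?expgSr // !inE !negb_or.
  by rewrite c_neq0 // !c_neq //; lia.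
have O1u : O 1%N = O u by apply: O_seg => // i; lia.
have Ouv : O u.+1 = O v by apply: O_seg => // i; lia.
have OvL : O v.+1 = O L by apply: O_seg => // i; lia.
have OL0 : O L = porbit (t * c) e0 by rewrite /O permX iter_porbit.
have O0 : porbit (t * c) e0 = O u.+1 by apply: OS; rewrite permM t0 expgSr permM.
have Ou : O u = O v.+1 by apply: OS; rewrite permM t1 expgSr permM.
have e1c : e1 \in porbit c e0 by apply: mem_porbit.
have e2c : e2 \in porbit c e0 by apply: mem_porbit.
have tcP e : (t * c) e \in porbit c e.
  rewrite permM; have : t e \in porbit c e.
    have [|/tD->] := boolP (e \in [:: e0; e1; e2]); last exact: porbit_id.
    rewrite !inE => /or3P[] /eqP->; rewrite ?t0 ?t1 ?t2 //.
    - by rewrite -eq_porbit_mem; move: e1c e2c; rewrite -!eq_porbit_mem => /eqP-> /eqP->.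
    - by rewrite porbit_sym.
  rewrite -!eq_porbit_mem => /eqP <-; rewrite eq_porbit_mem.
  by rewrite -{1}(expg1 c) mem_porbit.
have ctP e : c e \in porbit (t * c) e.
  rewrite -eq_porbit_mem; apply/eqP.
  have [|/tD te] := boolP (e \in [:: e0; e1; e2]); last first.
    by symmetry; apply: OS; rewrite permM te.
  rewrite !inE => /or3P[] /eqP->.
  - by rewrite -{1}(expg1 c) -/(O 1%N) O1u Ou OvL.
  - by rewrite -[c e1]permM -expgSr -/(O u.+1) -/(O u) Ou OvL OL0 O0.
  - by rewrite -[c e2]permM -expgSr -/(O v.+1) -/(O v) OvL OL0 O0.
by move=> e; apply/eqP; rewrite eqEsubset !sub_porbit.
Qed.
End ThreeCycles.

(** * Translations of Z/N *)

Section Translations.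
Import GRing.Theory.
Local Open Scope ring_scope.

Definition translation (V : finZmodType) (s : V) : {perm V} := perm (addIr s).

Lemma translationE (V : finZmodType) (s e : V) : translation s e = e + s.
Proof. by rewrite permE. Qed.

Lemma translationM (V : finZmodType) (s w : V) :
  (translation s * translation w)%g = translation (s + w).
Proof. by apply/permP => e; rewrite permM !translationE addrA. Qed.

Lemma translationX (V : finZmodType) (s e : V) i :
  (translation s ^+ i)%g e = e + s *+ i.
Proof.
elim: i => [|i IHi]; first by rewrite perm1 addr0.
by rewrite expgSr permM IHi translationE mulrSr addrA.
Qed.

Lemma translation_cycles (V : finZmodType) (s : V) a :
  (0 < a)%N -> (forall i, (s *+ i == 0) = (a %| i)%N) ->
  uniform_cycles (translation s) a.
Proof.
move=> a_gt0 s_ord; apply: uniform_cycles_expg => // e i.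
by rewrite translationX -subr_eq0 addrC addKr s_ord.
Qed.

Lemma val_ZpD N (e f : 'Z_N) : (1 < N)%N -> val (e + f) = ((e + f) %% N)%N.
Proof. by move=> N1; congr (_ %% _)%N; apply: Zp_cast. Qed.

Lemma Zp_nat_eq0 N n : (1 < N)%N -> ((n%:R : 'Z_N) == 0) = (N %| n)%N.
Proof. by move=> N1; rewrite -val_eqE /= val_Zp_nat. Qed.

Lemma Zp_val_natr N (e : 'Z_N) : (val e)%:R = e.
Proof. exact: natr_Zp. Qed.

Lemma Zp_opp_nat N m n :
  (1 < N)%N -> (m + n = N)%N -> - (m%:R : 'Z_N) = n%:R.
Proof.
by move=> N1 mnN; apply/eqP; rewrite eq_sym -addr_eq0 addrC -natrD Zp_nat_eq0 // mnN.
Qed.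

Lemma Zp_add_eq1 N s w : (1 < N)%N -> s + w = 1 %[mod N] ->
  (s%:R : 'Z_N) + w%:R = 1.
Proof.
move=> N_gt1 sw; rewrite -natrD -[RHS]/(1%N%:R); apply: val_inj.
by rewrite [LHS]val_Zp_nat // [RHS]val_Zp_nat.
Qed.

(** Turns a relation [e = f] into the vanishing of any d that [ring] identifies with e - f. *)
Lemma subr_eq0P (V : zmodType) (e f d : V) : e = f -> d = e - f -> d = 0.
Proof. by move=> -> ->; rewrite subrr. Qed.

(** The points 0, s, z occur in this order along the cycle e -> e + 1, so the 3-cycle only permutes
    its arcs. *)
Lemma cycle3_long_cycle N (s z e : 'Z_N) :
  (1 < N)%N -> (0 < s)%N -> (s < z)%N ->
  e \in porbit (cycle3 0 s z * translation 1%R)%g 0.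
Proof.
move=> N_gt1 s_gt0 ltsz.
have one_cyc : uniform_cycles (translation (1 : 'Z_N)) N.
  by apply: translation_cycles => [|i]; [apply: ltnW|apply: Zp_nat_eq0].
have ltzN : (z < N)%N by apply: leq_trans (ltn_ord z) _; rewrite Zp_cast.
have valE (f : 'Z_N) : (translation 1%R ^+ val f)%g 0 = f.
  by rewrite translationX add0r Zp_val_natr.
have := @porbit_cycle3 _ (translation (1 : 'Z_N)) 0 _ _ s_gt0 ltsz.
by rewrite one_cyc !valE => /(_ ltzN) ->; rewrite -(valE e) mem_porbit.
Qed.

End Translations.

(** * The regular dessin twisted by a 3-cycle *)

Lemma flip_bounds N q k : 2 < q -> 3 < (q * k)%N -> (k = 1 -> 6 < q)%N ->
  N = (2 * (q * k))%N -> [/\ 4 < N, q + 3 < N & 2 * q <= N]%N.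
Proof. by move=> q_gt2; case: k => [|[|k]] => qk k1 ->; split; nia. Qed.

Section Flip.
Import GRing.Theory.
Local Open Scope ring_scope.

Variables (N p a m : nat) (s w : 'Z_N).
Let z : 'Z_N := - p%:R.
Hypotheses (N_eq : N = (p * a)%N) (p_gt1 : (1 < p)%N) (a_gt3 : (3 < a)%N).
Hypotheses (s_ord : forall i, (s *+ i == 0) = (a %| i)%N) (p_dvd_s : (p %| s)%N).
Hypotheses (z_mult : s *+ m = z) (s_neq_z : s != z) (sw : s + w = 1).

(* 0, s and z = - p are consecutive in this order both around the face, where
   z is the last multiple of p, and along the cycle of multiples of s. *)
Definition flip_perm : {perm 'Z_N} := (cycle3 0%R s z * translation s)%g.
Let t := cycle3 0 s z.
Let x := flip_perm.
Let y := translation w.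
Let c := (x * y)%g.
(* The edges of the black vertex on which the rotation was changed. *)
Let I (e : 'Z_N) := (p %| e)%N.

Let a_gt0 : (0 < a)%N. Proof. exact: leq_trans a_gt3. Qed.

Let p_ltN : (p < N)%N.
Proof. by rewrite N_eq -{1}(muln1 p) ltn_pmul2l ?(ltnW p_gt1) // (leq_trans _ a_gt3). Qed.

Let N_gt1 : (1 < N)%N. Proof. exact: ltn_trans p_ltN. Qed.

Let I_add e f : I e -> I (e + f) = I f.
Proof.
rewrite /I => Ie; rewrite -[RHS](dvdn_addr _ Ie).
by rewrite val_ZpD // /dvdn modn_dvdm // N_eq dvdn_mulr.
Qed.

Let I0 : I 0. Proof. exact: dvdn0. Qed.

Let I_opp e : I (- e) = I e.
Proof.
by apply/idP/idP => Ie; have := I_add _ Ie; [rewrite -(I_add e Ie) addNr|rewrite -(I_add (- e) Ie) subrr].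
Qed.

Let I_nat n : I n%:R = (p %| n)%N.
Proof. by rewrite /I /= val_Zp_nat // /dvdn modn_dvdm // N_eq dvdn_mulr. Qed.

Let I1 : I 1 = false. Proof. by rewrite (I_nat 1) dvdn1; case: (p) p_gt1 => [|[]]. Qed.

Let Is : I s. Proof. exact: p_dvd_s. Qed.
Let Iz : I z. Proof. by rewrite I_opp I_nat. Qed.

Let Iw e : I (e + w) = I (e + 1).
Proof. by rewrite -sw addrCA (I_add _ Is). Qed.

Let z_neq0 : z != 0.
Proof. by rewrite oppr_eq0 Zp_nat_eq0 // gtnNdvd // ltnW. Qed.

Let s_neq0 : s != 0.
Proof. by rewrite -(mulr1n s) s_ord dvdn1; case: (a) a_gt3 => [|[]]. Qed.

Let s3 : s *+ 3 != 0. Proof. by rewrite s_ord gtnNdvd. Qed.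

Let tE : [/\ t 0 = s, t s = z, t z = 0 & forall e, e \notin [:: 0; s; z] -> t e = e].
Proof. by apply: cycle3E; rewrite // eq_sym. Qed.

Let xE e : x e = t e + s. Proof. by rewrite permM translationE. Qed.
Let cE e : c e = t e + 1. Proof. by rewrite permM xE translationE -addrA sw. Qed.

Let in_SP e : reflect [\/ e = 0, e = s | e = z] (e \in [:: 0; s; z]).
Proof.
rewrite !inE; apply: (iffP or3P); first by case=> /eqP; [constructor 1|constructor 2|constructor 3].
by case=> /eqP; [constructor 1|constructor 2|constructor 3].
Qed.

Let S_I e : e \in [:: 0; s; z] -> I e.
Proof. by case/in_SP=> ->. Qed.

Let t_nI e : ~~ I e -> t e = e.
Proof. by case: tE => _ _ _ tD nI; apply: tD; apply: contra nI; apply: S_I. Qed.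

Let tI e : I (t e - e).
Proof.
have [t0 ts tz tD] := tE.
have [/in_SP[]->|/tD->] := boolP (e \in [:: 0; s; z]); rewrite ?subrr //.
- by rewrite t0 subr0.
- by rewrite ts I_add // I_opp.
- by rewrite tz I_add // I_opp.
Qed.

Lemma flip_cycles : uniform_cycles x a.
Proof.
have s_cyc : uniform_cycles (translation s) a by apply: translation_cycles.
(* On the cycle of [translation s] through 0, z has exponent m mod a, which is neither 0 nor 1
   because z differs from 0 and s. *)
have zE : z = (translation s ^+ (m %% a))%g 0.
  rewrite translationX add0r -z_mult {1}(divn_eq m a) mulrnDr mulnC mulrnA.
  by have /eqP-> : s *+ a == 0 by [rewrite s_ord]; rewrite mul0rn add0r.
have sE : s = (translation s ^+ 1)%g 0 by rewrite translationX add0r.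
move=> e; rewrite -(s_cyc e) /x /flip_perm zE {1}sE porbit_cycle3 //.
- case: (m %% a)%N zE => [|[|//]]; first by rewrite translationX addr0 => /eqP; rewrite (negPf z_neq0).
  by rewrite translationX add0r => /eqP; rewrite eq_sym (negPf s_neq_z).
- by rewrite s_cyc ltn_mod.
Qed.

Lemma flip_full e : e \in porbit c 0.
Proof.
have -> : c = (cycle3 0%R s z * translation 1%R)%g.
  by rewrite /c /x /flip_perm -mulgA translationM sw.
(* z is represented by N - p, the largest multiple of p below N, so s precedes it. *)
have zv : nat_of_ord z = (a.-1 * p)%N.
  rewrite /z (Zp_opp_nat (n := (a.-1 * p)%N)) //; last first.
    by rewrite N_eq -[in RHS](prednK a_gt0) mulnS [(a.-1 * p)%N]mulnC.
  by rewrite val_Zp_nat // modn_small // N_eq mulnC ltn_pmul2l ?prednK // ltnW.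
have s_gt0 : (0 < s)%N by rewrite lt0n.
have s_lt : (s < a * p)%N.
  by rewrite mulnC -N_eq; apply: leq_trans (ltn_ord s) _; rewrite Zp_cast.
have s_neq : nat_of_ord s != (a.-1 * p)%N by rewrite -zv.
apply: cycle3_long_cycle => //; rewrite zv; move: s_lt s_neq.
case/dvdnP: p_dvd_s => k ->; rewrite !ltn_pmul2r ?eqn_pmul2r ?(ltnW p_gt1) //.
by rewrite -{1}(prednK a_gt0) ltnS => le_ka ne_ka; rewrite ltn_neqAle ne_ka.
Qed.

Section Symmetry.
Variable u : {perm 'Z_N}.
Hypotheses (ux : commute u x) (uy : commute u y).

Let uxE e : u (x e) = x (u e). Proof. by rewrite -!permM ux. Qed.
Let uyE e : u (e + w) = u e + w.
Proof. by rewrite -!translationE -!permM uy. Qed.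
Let ucE e : u (c e) = c (u e). Proof. by rewrite -!permM (commuteM ux uy). Qed.

(** [c] adds 1 modulo p, so a permutation commuting with it is a translation modulo p. *)
Let u_shift e : I (u e - e - u 0).
Proof.
have /porbitP[i ->] := flip_full e.
elim: i => [|i]; first by rewrite perm1 subr0 subrr.
rewrite expgSr permM; move: ((c ^+ i)%g 0) => f If; rewrite ucE !cE.
have -> : t (u f) + 1 - (t f + 1) - u 0 = (t (u f) - u f) + (- (t f - f) + (u f - f - u 0)) by ring.
by rewrite I_add // I_add // I_opp.
Qed.

Let I_shift e : I (u e) = I (e + u 0).
Proof. by rewrite -(I_add (e + u 0) (u_shift e)); congr I; ring. Qed.

(* Whether the two rotations commute at e. *)
Let P e := t e + w == t (e + w).

Let P_u e : P (u e) = P e.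
Proof.
have PE f : P f = (y (x f) == x (y f)).
  by rewrite !xE !translationE addrAC (inj_eq (addIr s)).
have uy' f : u (y f) = y (u f) by rewrite -!permM uy.
rewrite !PE -[RHS](inj_eq (@perm_inj _ u)).
by rewrite uy' !uxE uy'.
Qed.

Let nIw e : I e -> I (e + w) = false.
Proof. by move=> Ie; rewrite Iw I_add. Qed.

Let tS e : e \in [:: 0; s; z] -> t e \in [:: 0; s; z].
Proof.
have [t0 ts tz _] := tE; case/in_SP=> ->; apply/in_SP.
- by constructor 2; rewrite t0.
- by constructor 3; rewrite ts.
- by constructor 1; rewrite tz.
Qed.

(** t moves e but fixes e + w, which is not a multiple of p. By [SnP], any other edge outside P
    becomes 0, s or z when w is added. *)
Let nPS e : e \in [:: 0; s; z] -> ~~ P e.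
Proof.
move=> eS; rewrite /P (t_nI (e := e + w)) ?nIw ?S_I // (inj_eq (addIr w)).
have [t0 ts tz _] := tE.
by case/in_SP: eS => ->; rewrite ?t0 ?ts ?tz // 1?eq_sym // s_neq_z.
Qed.

Let SnP e : ~~ P e -> (e \in [:: 0; s; z]) || (e + w \in [:: 0; s; z]).
Proof.
have [_ _ _ tD] := tE.
by apply: contraR; rewrite negb_or => /andP[/tD te /tD tew]; rewrite /P te tew.
Qed.

Let u_fix0 : u 0 = 0 -> u = 1%g.
Proof. by move=> u0; apply: commute_cycle_fix flip_full ux uy u0. Qed.

Let uyE' e : u (y e) = y (u e). Proof. by rewrite -!permM uy. Qed.

Let xyI e : I e -> x (y e) = e + 1.
Proof. by move=> Ie; rewrite xE translationE t_nI ?nIw // -addrA [w + s]addrC sw. Qed.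

(** Here u maps {0, s, z} to itself and commutes with t there, so it fixes 0 or rotates the three
    edges. A rotation would give s + s = z and z + s = 0, hence 3 s = 0, against a > 3. *)
Lemma flip_symmetry_trivial : I (u 0) -> u = 1%g.
Proof.
move=> Iu0; have IuE e : I (u e) = I e by rewrite I_shift addrC I_add.
have uS e : e \in [:: 0; s; z] -> u e \in [:: 0; s; z].
  move=> eS; have /SnP/orP[] // : ~~ P (u e) by rewrite P_u nPS.
  by move/S_I; rewrite nIw // IuE S_I.
(* On multiples of p, [y] followed by [x] adds 1, while [c] is t followed by adding 1; u respects
   both, hence t. *)
have ut e : e \in [:: 0; s; z] -> u (t e) = t (u e).
  move=> eS; have Ite : I (t e) by apply/S_I/tS.
  have : x (y (t e)) = c e by rewrite xyI // cE.
  move/(congr1 u); rewrite ucE uxE uyE' xyI ?IuE // cE.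
  by move/addIr.
have [t0 ts tz _] := tE.
have u0S := uS 0 isT; case/in_SP: (u0S) => u0; first exact: u_fix0.
- have us : u s = z by rewrite -t0 ut // u0.
  have uz : u z = 0 by rewrite -ts ut ?us // !inE eqxx orbT.
  have sz : s + s = z by have := uxE z; rewrite uz !xE tz t0 add0r us => /esym.
  have zs : z + s = 0 by have := uxE 0; rewrite u0 !xE t0 ts sz uz.
  by case/negP: s3; rewrite !mulrS mulr0n addr0 sz addrC zs.
- have us : u s = 0 by rewrite -t0 ut // u0.
  have uz : u z = s by rewrite -ts ut ?us // !inE eqxx orbT.
  have zs : z + s = 0 by have := uxE z; rewrite uz !xE tz ts add0r us => /esym.
  have sz : s + s = z by have := uxE s; rewrite us !xE ts t0 zs u0 => /esym.
  by case/negP: s3; rewrite !mulrS mulr0n addr0 sz addrC zs.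
Qed.
(** Now u carries 0 into the translate of {0, s, z} by - w, and carries - w into {0, s, z}. Modulo p
    this makes u 0 equal to both - 1 and 1, so p = 2. *)
Lemma flip_symmetry_shift : ~~ I (u 0) ->
  [/\ p = 2%N, u 0 + w \in [:: 0; s; z] &
      forall e, e \in [:: 0; s; z] -> t (u (t e) + w) = u e + w].
Proof.
move=> nIu0; have [t0 _ _ _] := tE.
have u0S : u 0 + w \in [:: 0; s; z].
  by have /SnP/orP[/S_I|] // : ~~ P (u 0); rewrite ?(negPf nIu0) // P_u nPS.
have Iu1 : I (u 0 + 1) by rewrite -Iw S_I.
have nIV : I (- w) = false by rewrite I_opp -[w]add0r nIw.
have Iu1' : I (u 0 - 1).
  have nPV : ~~ P (- w) by rewrite /P addNr t0 t_nI ?nIV // addNr eq_sym.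
  have /SnP/orP[/S_I|/S_I] : ~~ P (u (- w)) by rewrite P_u.
    rewrite I_shift (_ : - w + u 0 = s + (u 0 - (s + w))); last by ring.
    by rewrite I_add // sw.
  by rewrite -uyE addNr (negPf nIu0).
have p2 : p = 2%N.
  have : (p <= 2)%N.
    apply: dvdn_leq => //; rewrite -I_nat -(I_add _ Iu1').
    by have -> : u 0 - 1 + 2%:R = u 0 + 1 by ring.
  by move=> p_le2; apply/eqP; rewrite eqn_leq p_le2.
split=> // e eS.
have nIu f : I f -> ~~ I (u f) by move=> If; rewrite I_shift I_add.
have Ite : I (t e) by apply/S_I/tS.
(* Both sides are t e + 1. Their images under u say that e -> u e + w conjugates t to its inverse on
   {0, s, z}. *)
have : x (y (t e)) = y (x e) by rewrite xyI // translationE xE -addrA sw.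
move/(congr1 u); rewrite uxE !uyE' uxE !xE !translationE (t_nI (nIu _ (S_I eS))).
by rewrite [RHS]addrAC => /addIr.
Qed.

(** Here s = 1 + q and z = - 2. Each possible value of u 0 + w determines u s, and evaluating u at c
    q = s in two ways ends in a relation on q that fails in Z/N, except for 2 q = 0. *)
Lemma flip_symmetry_trivial2 q k : p = 2%N -> a = (q * k)%N -> (2 < q)%N ->
  (k = 1%N -> 6 < q)%N -> w = - q%:R -> u = 1%g.
Proof.
move=> p2 aqk q_gt2 k1q wq.
have [/flip_symmetry_trivial//|nIu0] := boolP (I (u 0)).
have [_ u0S ut] := flip_symmetry_shift nIu0.
have [t0 ts tz tD] := tE.
pose Q : 'Z_N := q%:R.
have NE : N = (2 * (q * k))%N by rewrite N_eq p2 aqk.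
have k_gt0 : (0 < k)%N by case: (k) aqk a_gt3 => //; rewrite muln0 => ->.
have natr_neq0 n : (n%:R : 'Z_N) = 0 -> (0 < n)%N -> (N <= n)%N.
  by move=> /eqP n0 n_gt0; apply: dvdn_leq => //; rewrite -Zp_nat_eq0.
have sQ : s = 1 + Q by rewrite -sw wq -/Q subrK.
have zE : z = - 2%:R by rewrite /z p2.
have nIQ : ~~ I Q.
  have := Is; rewrite sQ addrC; apply: contraL => IQ.
  by rewrite I_add // I1.
have uQ e : u (e + Q) = u e + Q.
  by rewrite -[in RHS](addrK Q e) -wq uyE wq addrNK.
have uQ' e : u (e - Q) = u e - Q by rewrite -wq uyE.
have cQ : c Q = s by rewrite cE t_nI // sQ addrC.
have u_eq f : u 0 + w = f -> u 0 = f + Q by move=> <-; rewrite wq addrNK.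
have us f : u s + w = f -> u 1 = f.
  by move=> <-; rewrite wq -uQ' sQ addrK.
have t_inj e f : t e = t f -> e = f by apply: perm_inj.
have ut0 := ut 0; have uts := ut s; have utz := ut z.
rewrite t0 in ut0; rewrite ts in uts; rewrite tz in utz.
have s_in : s \in [:: 0; s; z] by rewrite !inE eqxx orbT.
have z_in : z \in [:: 0; s; z] by rewrite !inE eqxx !orbT.
move/(_ isT): ut0 => ut0; move/(_ s_in): uts => uts; move/(_ z_in): utz => utz.
have q_gt0 : (0 < q)%N by apply: leq_trans q_gt2.
(* These bounds keep the small constants that follow from vanishing in Z/N. *)
have [|N_gt4 N_gtq3 le2qN] := flip_bounds q_gt2 _ k1q NE; first by rewrite -aqk.
have natr0 n : (n%:R : 'Z_N) = 0 -> (0 < n < N)%N -> False.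
  by move=> /natr_neq0 n0 /andP[/n0 le_Nn]; rewrite ltnNge le_Nn.
have Q3 : Q + 3%:R = 0 -> False.
  by rewrite /Q -natrD => /natr0; apply; rewrite addn_gt0 q_gt0.
have Q1 : Q + 1 = 0 -> False.
  rewrite /Q -(natrD _ q 1) => /natr0; apply; rewrite addn_gt0 q_gt0 /=.
  by apply: leq_ltn_trans N_gtq3; rewrite leq_add2l.
have Qm i : (0 < i < q)%N -> Q - i%:R = 0 -> False.
  case/andP=> i_gt0 ltiq; rewrite /Q -natrB ?(ltnW ltiq) // => /natr0; apply.
  rewrite subn_gt0 ltiq (leq_trans _ le2qN) // mul2n -addnn.
  by rewrite (leq_ltn_trans (leq_subr _ _)) // -{1}(add0n q) ltn_add2r.
have Qm1 : Q - 1 = 0 -> False by apply: (Qm 1%N); rewrite (ltnW q_gt2).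
have QQ2 : Q + Q + 2%:R = 0 -> False.
  rewrite /Q -!natrD => /eqP; rewrite Zp_nat_eq0 // => N_dvd.
  have : (q %| q + q + 2)%N by apply: dvdn_trans N_dvd; rewrite NE mulnCA dvdn_mulr.
  rewrite dvdn_addr ?dvdn_add // => q2.
  by have := dvdn_leq (isT : (0 < 2)%N) q2; rewrite leqNgt q_gt2.
have n2 : (2%:R : 'Z_N) = 0 -> False by move/natr0; apply; rewrite (ltn_trans _ N_gt4).
have n4 : (4%:R : 'Z_N) = 0 -> False by move/natr0; apply.
have cuQ : t (u Q) + 1 = u s by rewrite -cQ ucE cE.
have uQ0 : u Q = u 0 + Q by rewrite -uQ add0r.
have us1 : u s = u 1 + Q by rewrite sQ uQ.
case/in_SP: u0S => e0.
- have es : u s + w = z by apply: t_inj; rewrite ut0 e0 tz.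
  move: cuQ; rewrite us1 (us _ es) uQ0 (u_eq _ e0) add0r.
  have [/in_SP[]e|/tD->] := boolP (Q + Q \in [:: 0; s; z]).
  + rewrite e t0 zE sQ => E; case: n4; apply: (subr_eq0P E); ring.
  + case: Qm1; apply: (subr_eq0P e); rewrite sQ; ring.
  + case: QQ2; apply: (subr_eq0P e); rewrite zE; ring.
  + rewrite zE => E; case: Q3; apply: (subr_eq0P E); ring.
- have es : u s + w = 0 by apply: t_inj; rewrite ut0 e0 t0.
  move: cuQ; rewrite us1 (us _ es) uQ0 (u_eq _ e0) add0r.
  have [/in_SP[]e|/tD->] := boolP (s + Q + Q \in [:: 0; s; z]).
  + rewrite e t0 sQ => E; case: n2; apply: (subr_eq0P E); ring.
  + rewrite e ts zE => E; case: Q1; apply: (subr_eq0P (esym E)); ring.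
  + rewrite e tz => E; case: Qm1; apply: (subr_eq0P (esym E)); ring.
  + rewrite sQ => E; case: QQ2; apply: (subr_eq0P E); ring.
- have es : u s + w = s by apply: t_inj; rewrite ut0 e0 ts.
  have ez : u z + w = 0 by apply: t_inj; rewrite uts es t0.
  move: cuQ; rewrite us1 (us _ es) uQ0 (u_eq _ e0).
  have [/in_SP[]e|/tD->] := boolP (z + Q + Q \in [:: 0; s; z]).
  + move=> _; apply: False_ind; apply: (@natr0 (2 * q.-1)%N).
      apply: (subr_eq0P e); rewrite zE natrM -subn1 natrB // -/Q; ring.
    rewrite muln_gt0 /= (leq_trans _ le2qN) ?ltn_pmul2l ?prednK ?ltnS //.
    by rewrite -ltnS prednK // (ltnW q_gt2).
  + rewrite e ts zE sQ => E; case: QQ2; apply: (subr_eq0P (esym E)); ring.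
  (* The surviving case 2 q = 0 means k = 1. Then u 2 = - 1 and u 3 = 0, but also u (q - 2) = 0, so
     q = 5 in Z/N, against q > 6. *)
  + move=> _; have QQ0 : Q + Q = 0 by apply: (subr_eq0P e); ring.
    have k1 : k = 1%N.
      apply/eqP; rewrite eqn_leq k_gt0 andbT -(@leq_pmul2l q) // -(@leq_pmul2l 2) // -NE muln1.
      by apply: natr_neq0; rewrite ?muln_gt0 // mul2n -addnn natrD.
    have nIQ' f : I f -> ~~ I (f + Q) by move=> If; rewrite I_add.
    have u2 : u 2%:R = - 1.
      have : u (c 0) = c (u 0) by rewrite ucE.
      rewrite !cE t0 (u_eq _ e0) t_nI ?nIQ' // sQ (_ : 1 + Q + 1 = 2%:R + Q); last by ring.
      rewrite uQ zE => E; apply/eqP; rewrite -subr_eq0; apply/eqP; apply: (subr_eq0P E); ring.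
    have u3 : u 3%:R = 0.
      have c2 : c 2%:R = 3%:R.
        rewrite cE tD; first by ring.
        apply/in_SP=> -[] E; first exact: n2.
        - by apply: Qm1; apply: (subr_eq0P (esym E)); rewrite sQ; ring.
        - by apply: n4; apply: (subr_eq0P E); rewrite zE; ring.
      by rewrite -c2 ucE u2 cE t_nI ?addNr // I_opp I1.
    have uzQ : u (z + Q) = 0.
      by rewrite uQ -[u z]subr0 -{2}QQ0 -ez wq; ring.
    have E : z + Q = 3%:R by apply: (@perm_inj _ u); rewrite uzQ u3.
    case: (Qm 5%N); first exact: ltn_trans (k1q k1).
    by apply: (subr_eq0P E); rewrite zE; ring.
  + rewrite zE sQ => E; case: n2; apply: (subr_eq0P (esym E)); ring.
Qed.

End Symmetry.
End Flip.

(** * Passports with coprime p and q *)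

Section FlipTriples.
Import GRing.Theory.
Local Open Scope ring_scope.

Lemma Zp_mulrn_eq0 N d a s i : (1 < N)%N -> N = (d * a)%N -> gcdn s N = d ->
  ((s%:R : 'Z_N) *+ i == 0) = (a %| i)%N.
Proof.
move=> N_gt1 N_eq sN; rewrite -mulrnA Zp_nat_eq0 //.
have d_gt0 : (0 < d)%N by rewrite -sN gcdn_gt0 (ltnW N_gt1) orbT.
have /dvdnP[s' s_eq] : (d %| s)%N by rewrite -sN dvdn_gcdl.
have co_s'a : coprime a s'.
  move: sN; rewrite s_eq N_eq mulnC -muln_gcdr -{2}(muln1 d) => /eqP.
  by rewrite eqn_pmul2l // gcdnC.
by rewrite N_eq s_eq mulnAC mulnC dvdn_pmul2r // Gauss_dvdr.
Qed.

Lemma flip_triple N p q a b s w :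
  (1 < p)%N -> (3 < a)%N -> N = (p * a)%N -> N = (q * b)%N ->
  gcdn s N = p -> gcdn w N = q -> s + w = 1 %[mod N] ->
  (s%:R : 'Z_N) != - p%:R ->
  (2 < p)%N \/ p = 2%N /\ (exists k, [/\ a = (q * k)%N, 2 < q, (k = 1 -> 6 < q) &
     (w%:R : 'Z_N) = - q%:R])%N ->
  asymmetric_triple N a b N.
Proof.
move=> p_gt1 a_gt3 Npa Nqb sN wN sw s_neq pP.
have N_gt1 : (1 < N)%N by rewrite Npa; nia.
have b_gt0 : (0 < b)%N by case: (b) Nqb N_gt1; rewrite ?muln0 // => ->.
have s_gt0 : (0 < s)%N by case: (s) sN => //; rewrite gcd0n Npa; nia.
have s_ord := Zp_mulrn_eq0 _ N_gt1 Npa sN.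
have w_ord := Zp_mulrn_eq0 _ N_gt1 Nqb wN.
have p_dvd_s : (p %| (s%:R : 'Z_N))%N.
  by rewrite val_Zp_nat // /dvdn modn_dvdm ?Npa ?dvdn_mulr // -/(dvdn _ _) -sN dvdn_gcdl.
have [m z_mult] : exists m, (s%:R : 'Z_N) *+ m = - p%:R.
  (* Bezout writes p as a multiple of s modulo N; the factor [N.-1] changes the sign. *)
  case: (egcdnP N s_gt0) => k l; rewrite sN => kl _; exists (k * N.-1)%N.
  have N0 : (N%:R : 'Z_N) = 0 by apply/eqP; rewrite Zp_nat_eq0.
  rewrite -mulrnA mulnA [(s * k)%N]mulnC kl mulrnA natrD natrM N0 mulr0 add0r.
  apply/eqP; rewrite -addr_eq0 -mulrSr prednK ?(ltnW N_gt1) //.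
  by rewrite -(mulr_natr (p%:R : 'Z_N) N) N0 mulr0.
have sw1 := Zp_add_eq1 N_gt1 sw.
have cardN : N = #|'Z_N| by rewrite card_ord Zp_cast.
rewrite [X in asymmetric_triple X _ _ _]cardN [X in asymmetric_triple _ _ _ X]cardN.
apply: (@asymmetric_triple_of_cycle _ (flip_perm p s%:R) (translation w%:R) _ _ 0).
- exact: flip_cycles z_mult s_neq.
- exact: translation_cycles.
- exact: flip_full s_ord p_dvd_s s_neq sw1.
move=> u ux uy.
case: pP => [p_gt2|[p2 [k [aqk q_gt2 k1q wq]]]]; last first.
  exact: flip_symmetry_trivial2 s_ord p_dvd_s s_neq sw1 _ ux uy _ _ p2 aqk q_gt2 k1q wq.
have [|nI] := boolP (p %| val (u 0%R))%N.
  exact: flip_symmetry_trivial s_ord p_dvd_s s_neq sw1 _ ux uy.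
have [p2 _ _] := flip_symmetry_shift Npa p_gt1 a_gt3 s_ord p_dvd_s s_neq sw1 ux uy nI.
by rewrite p2 in p_gt2.
Qed.

(** The white rotation is twisted when b > 3 and w differs from - q, which suffices since q > 2.
    Otherwise the black one is twisted; then s differs from - p, and p = 2 forces w = - q. *)
Lemma coprime_triple a b p q n :
  n = (p * a)%N -> n = (q * b)%N -> coprime p q -> (1 < p)%N -> (p < q)%N ->
  odd (n + p + q) -> (p + q + 3 <= n)%N -> (q, b) != (5, 2)%N -> (q, b) != (4, 3)%N ->
  asymmetric_triple n a b n.
Proof.
move=> npa nqb co_pq p_gt1 ltpq odd_n genus_n qb52 qb43.
have n_gt0 : (0 < n)%N by lia.
have n_gt1 : (1 < n)%N by lia.
have q_gt2 : (2 < q)%N by lia.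
have [||s [w [sn wn sw]]] := exists_rotations n_gt0 _ _ co_pq odd_n.
- by rewrite npa dvdn_mulr.
- by rewrite nqb dvdn_mulr.
have ws : w + s = 1 %[mod n] by rewrite addnC.
have /dvdnP[k aqk] : (q %| a)%N.
  by rewrite -(@Gauss_dvdr q p) 1?coprime_sym // -npa nqb dvdn_mulr.
have /dvdnP[l bpl] : (p %| b)%N.
  by rewrite -(@Gauss_dvdr p q) // -nqb npa dvdn_mulr.
have kl : k = l.
  apply/eqP; rewrite -(@eqn_pmul2l (p * q)); last by rewrite muln_gt0; lia.
  have -> : (p * q * k = p * a)%N by rewrite aqk; ring.
  by rewrite -npa nqb bpl; apply/eqP; ring.
subst k; have l_gt0 : (0 < l)%N by case: (l) bpl nqb => //; lia.
have a_gt3 : (3 < a)%N.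
  have leqa : (q <= a)%N by rewrite aqk leq_pmull.
  rewrite ltnNge; apply/negP => a_le3; have p2 : p = 2%N by lia.
  by move: genus_n; rewrite npa p2; lia.
have natr_mod i j : (i%:R : 'Z_n) = j%:R -> i = j %[mod n].
  by move=> /(congr1 val) /=; rewrite !val_Zp_nat.
have natr_eq0 i : (i%:R : 'Z_n) = 0 -> (0 < i)%N -> (n <= i)%N.
  by move=> /eqP; rewrite Zp_nat_eq0 // => n_i i_gt0; apply: dvdn_leq.
have [/andP[b_gt3 nwq]|wqP] := boolP ((3 < b)%N && (w%:R != - q%:R :> 'Z_n)).
  exact: asymmetric_triple_swap (flip_triple (ltnW q_gt2) b_gt3 nqb npa wn sn ws nwq (or_introl q_gt2)).
(* If s = - p then w = p + 1 is divisible by q, so q = p + 1. Then b <= 3 leaves only (q, b) = (4,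
   3), and w = - q contradicts the genus bound. *)
have s_neq : (s%:R : 'Z_n) != - p%:R.
  apply/eqP => sp; have w_eq : (w%:R : 'Z_n) = (p + 1)%:R.
    by apply: (addrI s%:R); rewrite (Zp_add_eq1 n_gt1 sw) natrD sp addKr.
  have q_eq : q = p.+1.
    apply/eqP; rewrite eqn_leq ltpq andbT; apply: dvdn_leq => //.
    have q_n : (q %| n)%N by rewrite -wn dvdn_gcdr.
    rewrite -addn1 /dvdn -(modn_dvdm _ q_n) -(natr_mod _ _ w_eq) modn_dvdm //.
    by rewrite -/(dvdn _ _) -wn dvdn_gcdl.
  case/nandP: wqP => [b_le3|/negPn/eqP wq].
    have l1 : l = 1%N.
      apply/eqP; rewrite eqn_leq l_gt0 andbT leqNgt; apply: contra b_le3 => l_gt1.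
      by rewrite bpl (leq_mul l_gt1 p_gt1).
    move: qb43 b_le3 a_gt3; rewrite q_eq bpl aqk l1 !mul1n q_eq -leqNgt.
    by case: (p) p_gt1 => [|[|[|[|]]]].
  have := natr_eq0 (p + 1 + q)%N; rewrite natrD -w_eq wq addNr => /(_ erefl).
  by lia.
have [p_gt2|p_le2] := ltnP 2 p.
  exact: flip_triple p_gt1 a_gt3 npa nqb sn wn sw s_neq (or_introl p_gt2).
have p2 : p = 2%N by lia.
have wq : (w%:R : 'Z_n) = - q%:R.
  case/nandP: wqP => [b_le3|/negPn/eqP//].
  have l1 : l = 1%N by move: b_le3; rewrite bpl p2; lia.
  have n2q : n = (2 * q)%N by rewrite nqb bpl p2 l1 mulnC.
  have /dvdnP[w' w_eq] : (q %| w)%N by rewrite -wn dvdn_gcdl.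
  have w'_odd : odd w'.
    move: wn; rewrite w_eq n2q -muln_gcdl => /eqP.
    by rewrite -[X in _ == X](mul1n q) eqn_pmul2r ?(ltnW (ltnW q_gt2)) // -/(coprime w' 2) coprimen2.
  apply/eqP; rewrite -addr_eq0 -natrD Zp_nat_eq0 // w_eq n2q addnC -mulSn dvdn_pmul2r ?dvdn2 /=.
    by rewrite w'_odd.
  exact: ltnW (ltnW q_gt2).
(* For l = 1, n = 2 q: q is odd and at least 5 by the genus bound, and 5 is excluded. *)
have lq : (l = 1 -> 6 < q)%N.
  move=> l1; have : odd q by move: co_pq; rewrite p2 coprime2n.
  move: genus_n qb52; rewrite nqb bpl p2 l1; case: (q) q_gt2 => [|[|[|[|[|[|[|]]]]]]] //; lia.
apply: flip_triple p_gt1 a_gt3 npa nqb sn wn sw s_neq (or_intror (conj p2 _)).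
by exists l; rewrite mulnC -aqk.
Qed.
End FlipTriples.

(** * Cyclic covers of the regular dessin *)

Section Cover.
Import GRing.Theory.
Local Open Scope ring_scope.

Variables (N : nat) (F : finType).
Local Notation T := ('Z_N * F)%type.
Implicit Types (d r : 'Z_N) (v : F) (Y : 'Z_N -> {perm F}).

Definition skew_fun d Y (e : T) : T := (e.1 + d, Y e.1 e.2).

Lemma skew_fun_inj d Y : injective (skew_fun d Y).
Proof.
move=> [r v] [r' v'] /eqP.
by rewrite xpair_eqE /= => /andP[/eqP/addIr rr' /eqP]; rewrite rr' => /perm_inj ->.
Qed.

Definition skew d Y : {perm T} := perm (@skew_fun_inj d Y).

Lemma skewE d Y r v : skew d Y (r, v) = (r + d, Y r v).
Proof. by rewrite permE. Qed.

Definition trivial_cocycle : 'Z_N -> {perm F} := fun=> 1%g.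

Lemma skew_cycles d a : (0 < a)%N -> (forall i, (d *+ i == 0) = (a %| i)%N) ->
  uniform_cycles (skew d trivial_cocycle) a.
Proof.
move=> a_gt0 d_ord; apply: uniform_cycles_expg => // -[r v] i.
have -> : (skew d trivial_cocycle ^+ i)%g (r, v) = (r + d *+ i, v).
  elim: i => [|i IHi]; first by rewrite perm1 addr0.
  by rewrite expgSr permM IHi skewE perm1 mulrSr addrA.
by rewrite xpair_eqE eqxx andbT -subr_eq0 addrC addKr d_ord.
Qed.

Variables (s w : 'Z_N) (g : 'Z_N -> {perm F}).
Hypothesis sw : s + w = 1.

Definition cover_black : {perm T} := skew s trivial_cocycle.
Definition cover_white : {perm T} := (skew w trivial_cocycle ^ skew 0%R g)%g.

(* The gauge g makes the holonomy around each white vertex trivial. *)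
Definition holonomy r : {perm F} := ((g r)^-1 * g (r + w))%g.

Lemma cover_blackE r v : cover_black (r, v) = (r + s, v).
Proof. by rewrite skewE perm1. Qed.

Lemma cover_whiteE r v : cover_white (r, v) = (r + w, holonomy r v).
Proof.
have -> : cover_white (r, v) = skew 0 g (skew w trivial_cocycle ((skew 0 g)^-1%g (r, v))).
  by rewrite /cover_white conjgE !permM.
have -> : (skew 0 g)^-1%g (r, v) = (r, (g r)^-1%g v).
  by apply: (canLR (permK _)); rewrite skewE addr0 permKV.
by rewrite !skewE perm1 addr0 permM.
Qed.

Lemma cover_faceE r v :
  (cover_black * cover_white)%g (r, v) = (r + 1, holonomy (r + s) v).
Proof. by rewrite permM cover_blackE cover_whiteE -addrA sw. Qed.

Lemma cover_white_cycles b :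
  (0 < b)%N -> (forall i, (w *+ i == 0) = (b %| i)%N) ->
  uniform_cycles cover_white b.
Proof. by move=> b_gt0 w_ord; apply: uniform_cyclesJ; apply: skew_cycles. Qed.

Lemma cover_face_fst i e :
  (((cover_black * cover_white) ^+ i)%g e).1 = e.1 + i%:R.
Proof.
elim: i => [|i]; first by rewrite perm1 addr0.
rewrite expgSr permM; case: (((cover_black * cover_white) ^+ i)%g e) => r v /= IHi.
by rewrite cover_faceE /= IHi -addrA -mulrSr.
Qed.

(** N steps of the face return to the fibre over [r0] and act there by [d]. If the iterates of [d]
    reach the whole fibre, the cover has a single face. *)
Lemma cover_face_full r0 v0 (d : F -> F) :
  (1 < N)%N ->
  (forall v, ((cover_black * cover_white) ^+ N)%g (r0, v) = (r0, d v)) ->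
  (forall v, exists i, iter i d v0 = v) ->
  forall e, e \in porbit (cover_black * cover_white)%g (r0, v0).
Proof.
move=> N_gt1 cN d_full [r v]; set c := (_ * _)%g in cN *.
pose j := val (r - r0).
have jE : j%:R = r - r0 by apply: Zp_val_natr.
pose v'' := ((c ^+ j)%g^-1%g (r, v)).2.
have e_eq : ((c ^+ j)%g^-1%g (r, v)) = (r0, v'').
  rewrite [LHS]surjective_pairing -/v''; congr (_, _).
  have := cover_face_fst j ((c ^+ j)%g^-1%g (r, v)).
  by rewrite permKV /= jE => /(canLR (addrK _)) <-; rewrite opprB addrC subrK.
have [i iE] := d_full v''; apply/porbitP; exists (N * i + j)%N.
have -> : (c ^+ (N * i + j))%g (r0, v0) = (c ^+ j)%g ((c ^+ (N * i))%g (r0, v0)).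
  by rewrite expgD permM.
suff -> : (c ^+ (N * i))%g (r0, v0) = (r0, v'') by rewrite -e_eq permKV.
rewrite -iE; elim: i {iE} => [|i IHi]; first by rewrite muln0 perm1.
by rewrite mulnS addnC expgD permM IHi cN.
Qed.

Section Symmetry.
Variable u : {perm T}.
Hypotheses (ux : commute u cover_black) (uy : commute u cover_white).
Variables (e0 : T) (full : forall e, e \in porbit (cover_black * cover_white)%g e0).

Definition sym_shift : 'Z_N := (u e0).1 - e0.1.
Definition sym_fibre r v : F := (u (r, v)).2.

(** Powers of the face rotation translate the base by their exponent and reach every edge, so u
    covers a translation of the base. *)
Lemma sym_fst e : (u e).1 = e.1 + sym_shift.
Proof.
have /porbitP[i ->] := full e.
rewrite -permM -(commuteX i (commuteM ux uy)) permM.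
by rewrite !(cover_face_fst i) /= /sym_shift; ring.
Qed.

Lemma symE r v : u (r, v) = (r + sym_shift, sym_fibre r v).
Proof. by rewrite [LHS]surjective_pairing sym_fst. Qed.

Lemma sym_fibre_inj r : injective (sym_fibre r).
Proof.
move=> v v' eq_vv'; have : u (r, v) = u (r, v') by rewrite !symE eq_vv'.
by move/perm_inj => [].
Qed.

Lemma sym_fibreDs r v : sym_fibre (r + s) v = sym_fibre r v.
Proof.
have : u (cover_black (r, v)) = cover_black (u (r, v)) by rewrite -!permM ux.
by rewrite cover_blackE !symE cover_blackE => /(congr1 snd).
Qed.

Lemma sym_fibreDsn r v i : sym_fibre (r + s *+ i) v = sym_fibre r v.
Proof. by elim: i => [|i IHi]; rewrite ?addr0 // mulrSr addrA sym_fibreDs. Qed.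

Lemma sym_fibreDw r v :
  sym_fibre (r + w) (holonomy r v) = holonomy (r + sym_shift) (sym_fibre r v).
Proof.
have : u (cover_white (r, v)) = cover_white (u (r, v)) by rewrite -!permM uy.
by rewrite cover_whiteE !symE cover_whiteE => /(congr1 snd).
Qed.

Lemma sym_fibreD1 r v :
  sym_fibre (r + 1) (holonomy r v) = holonomy (r + sym_shift) (sym_fibre r v).
Proof. by rewrite -sw [s + w]addrC addrA sym_fibreDs sym_fibreDw. Qed.

(** [sym_fibre] is constant along the multiples of s, so one pair of bijections intertwines all
    holonomies of a coset and preserves where two of them agree. *)
Lemma holonomy_shift r i v :
  (holonomy (r + s *+ i + sym_shift) (sym_fibre r v) == holonomy (r + sym_shift) (sym_fibre r v))
  = (holonomy (r + s *+ i) v == holonomy r v).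
Proof.
rewrite -(sym_fibreDsn r v i) -!sym_fibreDw sym_fibreDsn -sym_fibreDw addrAC.
by rewrite sym_fibreDsn (inj_eq (@sym_fibre_inj _)).
Qed.

Lemma sym_fix_eq1 r v : u (r, v) = (r, v) -> u = 1%g.
Proof. exact: commute_cycle_fix full ux uy. Qed.

End Symmetry.
End Cover.

(** * The cover with holonomies v + 1 and 2 v *)

Section AffineCover.
Import GRing.Theory.
Local Open Scope ring_scope.

Variables (N K : nat) (s w : 'Z_N).
Hypotheses (N_gt2 : (2 < N)%N) (K_gt2 : (2 < K)%N) (K_odd : odd K).
Hypotheses (sw : s + w = 1) (w0 : w != 0) (w1 : w != 1) (wN1 : w + 1 != 0).

Let N_gt1 : (1 < N)%N. Proof. exact: ltnW. Qed.
Let K_gt1 : (1 < K)%N. Proof. exact: ltnW. Qed.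

Definition half : 'Z_K := (K.+1)./2%:R.

Lemma double_half : half *+ 2 = 1.
Proof.
have K0 : (K%:R : 'Z_K) = 0 by apply/eqP; rewrite Zp_nat_eq0.
have K1 : ((K.+1)./2 * 2 = K.+1)%N by rewrite muln2 even_halfK // negbK.
by rewrite /half -mulrnA K1 mulrS K0 addr0.
Qed.

Let dblK (v : 'Z_K) : v *+ 2 * half = v.
Proof. by rewrite mulrnAl -mulrnAr double_half mulr1. Qed.

Let dblI : injective (fun v : 'Z_K => v *+ 2).
Proof. by move=> v v' /= eq2; rewrite -[v]dblK eq2 dblK. Qed.

Definition dbl : {perm 'Z_K} := perm dblI.

(** This gauge gives the holonomy v + 1 at 0 and 2 v at 1, their inverses at w and w + 1, and the
    identity elsewhere, so that the face carries a commutator. *)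
Definition affine_gauge (r : 'Z_N) : {perm 'Z_K} :=
  if r == w then translation 1 else if r == w + 1 then dbl else 1%g.

Local Notation hol := (holonomy w affine_gauge).

Let one_neq0 : (1 : 'Z_N) != 0.
Proof. by rewrite (Zp_nat_eq0 1) // dvdn1 -[1%N]/(1%N) gtn_eqF. Qed.

Let holE r v : hol r v = affine_gauge (r + w) ((affine_gauge r)^-1%g v).
Proof. by rewrite permM. Qed.

Let add_eqw r : (r + w == w) = (r == 0).
Proof. by rewrite -[X in _ == X]add0r (inj_eq (addIr w)). Qed.

Let add_eqw1 r : (r + w == w + 1) = (r == 1).
Proof. by rewrite [w + 1]addrC (inj_eq (addIr w)). Qed.

Let eq0w : (0 == w) = false. Proof. by rewrite eq_sym (negPf w0). Qed.
Let eq0w1 : (0 == w + 1) = false. Proof. by rewrite eq_sym (negPf wN1). Qed.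
Let eq1w : (1 == w) = false. Proof. by rewrite eq_sym (negPf w1). Qed.
Let eqww1 : (w == w + 1) = false.
Proof. by rewrite -{1}[w]add0r add_eqw1 eq_sym (negPf one_neq0). Qed.
Let eq1w1 : (1 == w + 1) = false.
Proof. by rewrite eq_sym -[X in _ == X]add0r (inj_eq (addIr 1)) (negPf w0). Qed.

Let hol0 v : hol 0 v = v + 1.
Proof. by rewrite holE /affine_gauge add0r eqxx eq0w eq0w1 invg1 perm1 translationE. Qed.

Let holw v : hol w v = v - 1.
Proof.
rewrite holE /affine_gauge add_eqw add_eqw1 (negPf w0) (negPf w1) eqxx perm1.
by apply: (canLR (permK _)); rewrite translationE subrK.
Qed.

Let hol1 v : hol 1 v = v *+ 2.
Proof.
rewrite holE /affine_gauge add_eqw add_eqw1 eqxx (negPf one_neq0) eq1w eq1w1.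
by rewrite invg1 perm1 permE.
Qed.

Let holw1 v : hol (w + 1) v *+ 2 = v.
Proof.
rewrite holE /affine_gauge add_eqw add_eqw1 (negPf wN1) eqxx [w + 1 == w]eq_sym eqww1.
rewrite [w + 1 == 1]eq_sym eq1w1 perm1.
have dblE v' : dbl v' = v' *+ 2 by rewrite permE.
by rewrite -dblE permKV.
Qed.

Let holD r v : r != 0 -> r != w -> r != 1 -> r != w + 1 -> hol r v = v.
Proof.
move=> r0 rw r1 rw1; rewrite holE /affine_gauge add_eqw add_eqw1.
by rewrite (negPf rw) (negPf rw1) (negPf r0) (negPf r1) invg1 !perm1.
Qed.

Let c := (@cover_black N 'Z_K s * @cover_white N 'Z_K w affine_gauge)%g.

Let Zp_nat_eq i j : (i < N)%N -> (j < N)%N -> ((i%:R : 'Z_N) == j%:R) = (i == j).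
Proof. by move=> iN jN; rewrite -val_eqE /= !val_Zp_nat // !modn_small. Qed.

Let wE : w = (val w)%:R. Proof. by rewrite Zp_val_natr. Qed.

Let w_bounds : (1 < val w)%N /\ (val w + 1 < N)%N.
Proof.
have wN : (val w < N)%N by apply: leq_trans (ltn_ord w) _; rewrite Zp_cast.
split.
  have : val w != 0%N by rewrite -Zp_nat_eq -?wE // ltnW.
  have : val w != 1%N by rewrite -Zp_nat_eq -?wE.
  by case: (val w) => [|[|]].
have : (val w + 1 <= N)%N by rewrite addn1.
rewrite leq_eqVlt => /orP[/eqP wN1'|//]; move: wN1.
by rewrite {1}wE -[1]/(1%N%:R) -natrD wN1' Zp_nat_eq0 ?dvdnn.
Qed.

(** From - s the face meets the holonomies at 0, 1, 2, ... in turn. The nontrivial ones are v + 1, 2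
    v, v - 1 and v / 2, and their composite is v + 1/2. *)
Lemma affine_cover_turn v : (c ^+ N)%g (- s, v) = (- s, v + half).
Proof.
have [w_gt1 w_lt] := w_bounds.
pose f j := ((c ^+ j)%g (- s, v)).2.
have fst_c j : ((c ^+ j)%g (- s, v)).1 = - s + j%:R by rewrite (cover_face_fst _ sw).
have fS j : f j.+1 = hol j%:R (f j).
  rewrite /f expgSr permM; have := fst_c j; case: ((c ^+ j)%g _) => r v' /= ->.
  by rewrite (cover_faceE _ sw) /= addrAC addNr add0r.
have f0 : f 0%N = v by rewrite /f perm1.
have holD' j x : (j < N)%N -> j != 0%N -> j != 1%N -> j != val w -> j != (val w + 1)%N ->
    hol j%:R x = x.
  move=> jN j0 j1 jw jw1; apply: holD.
  - by rewrite (Zp_nat_eq (j := 0%N)) // ltnW // ltnW.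
  - by rewrite wE Zp_nat_eq // (leq_trans _ w_lt) // leq_addr.
  - by rewrite (Zp_nat_eq (j := 1%N)).
  - by rewrite wE -[1]/(1%N%:R) -natrD Zp_nat_eq.
have f_seg l h : (l <= h)%N ->
    (forall j, (l <= j < h)%N -> [&& j < N, j != 0, j != 1, j != val w & j != val w + 1]%N) ->
    f h = f l.
  move=> le_lh; elim: h le_lh => [|h IHh]; first by rewrite leqn0 => /eqP->.
  rewrite leq_eqVlt => /orP[/eqP-> //|]; rewrite ltnS => le_lh jP.
  have /and5P[hN h0 h1 hw hw1] : [&& h < N, h != 0, h != 1, h != val w & h != val w + 1]%N.
    by apply: jP; rewrite le_lh ltnSn.
  rewrite fS holD' //; apply: IHh => // j /andP[lj jh].
  by apply: jP; rewrite lj ltnW.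
have f1 : f 1%N = v + 1 by rewrite fS f0 hol0.
have f2 : f 2%N = (v + 1) *+ 2 by rewrite fS f1 (hol1 _).
have fw : f (val w) = (v + 1) *+ 2.
  rewrite -f2; apply: f_seg => // j; clear - w_gt1 w_lt; lia.
have fw1 : f (val w).+1 = (v + 1) *+ 2 - 1 by rewrite fS -wE holw fw.
have w1E : ((val w).+1%:R : 'Z_N) = w + 1 by rewrite mulrSr -wE.
have fw2 : f (val w).+2 *+ 2 = (v + 1) *+ 2 - 1 by rewrite fS w1E holw1 fw1.
have fN : f N *+ 2 = (v + 1) *+ 2 - 1.
  rewrite -fw2; congr (_ *+ 2); apply: f_seg; first by rewrite -addn1 addSn.
  by move=> j; clear - w_gt1 w_lt; lia.
rewrite [LHS]surjective_pairing fst_c -/(f N); congr (_, _).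
  by rewrite (_ : N%:R = 0) ?addr0 //; apply/eqP; rewrite Zp_nat_eq0.
by apply: dblI => /=; rewrite fN [RHS]mulrnDl double_half; ring.
Qed.

Lemma affine_cover_full e : e \in porbit c (- s, 0).
Proof.
apply: (cover_face_full sw N_gt1 (d := fun v => v + half)) => [|v].
  exact: affine_cover_turn.
(* Two turns add 1. *)
exists (val v * 2)%N; rewrite -[RHS]Zp_val_natr; elim: (val v) => // i IHi.
by rewrite mulSn iterD IHi /= -addrA -mulr2n double_half -mulrSr.
Qed.
Section AffineSymmetry.
Variable a : nat.
Hypotheses (a_gt2 : (2 < a)%N) (s_ord : forall i, (s *+ i == 0) = (a %| i)%N).
Variable u : {perm 'Z_N * 'Z_K}.
Hypotheses (ux : commute u (@cover_black N 'Z_K s)).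
Hypotheses (uy : commute u (cover_white w affine_gauge)).

Let j := sym_shift u (- s, 0).
Let sig := sym_fibre u.

Let sigD1 r v : sig (r + 1) (hol r v) = hol (r + j) (sig r v).
Proof. exact: (sym_fibreD1 sw ux uy affine_cover_full). Qed.

Let sigDs r v : sig (r + s) v = sig r v.
Proof. exact: (sym_fibreDs sw ux uy affine_cover_full). Qed.

Let sigDsn r i v : sig (r + s *+ i) v = sig r v.
Proof. exact: (sym_fibreDsn sw ux uy affine_cover_full). Qed.

Let hol_shift r i v :
  (hol (r + s *+ i + j) (sig r v) == hol (r + j) (sig r v)) = (hol (r + s *+ i) v == hol r v).
Proof. exact: (holonomy_shift sw ux uy affine_cover_full). Qed.

(** The positions whose holonomy is multiplication by 2 or by 1/2; at the others it is translation
    by [eps]. *)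
Let M (r : 'Z_N) := (r == 1) || (r == w + 1).
Let eps (r : 'Z_N) : 'Z_K := if r == 0 then 1 else if r == w then - 1 else 0.

Let nM0 : ~~ M 0. Proof. by rewrite /M eq0w1 eq_sym (negPf one_neq0). Qed.
Let nMw : ~~ M w. Proof. by rewrite /M eqww1 eq_sym eq1w. Qed.

Let hol_eps r v : ~~ M r -> hol r v = v + eps r.
Proof.
rewrite /M negb_or /eps => /andP[r1 rw1].
have [->|r0] := eqVneq r 0; first exact: hol0.
have [->|rw] := eqVneq r w; first exact: holw.
by rewrite addr0 holD.
Qed.

Let hol_half v : hol (w + 1) (v *+ 2) = v.
Proof. by apply: dblI; rewrite holw1. Qed.

(** Both 2 v = v + d and v / 2 = v + d are solvable, and two multiplications agree at 0. *)
Let hol_common e r : M e -> exists v, hol e v = hol r v.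
Proof.
have M0 f : M f -> hol f 0 = 0.
  by case/orP=> /eqP->; [rewrite hol1 mul0rn|rewrite -[X in hol _ X](mul0rn _ 2) hol_half].
move=> Me; have [Mr|nMr] := boolP (M r); first by exists 0; rewrite !M0.
case/orP: Me => /eqP->.
  by exists (eps r); rewrite hol1 hol_eps // mulr2n.
by exists ((- eps r) *+ 2); rewrite hol_half hol_eps // mulr2n subrK.
Qed.

Let oneK_neq0 : (1 : 'Z_K) != 0.
Proof. by rewrite (Zp_nat_eq0 1) // dvdn1 gtn_eqF. Qed.

Let hol_differ e r : M e -> ~~ M r -> exists v, hol e v != hol r v.
Proof.
move=> /orP[] /eqP-> nMr.
  exists (eps r + 1); rewrite hol1 hol_eps // mulr2n (inj_eq (addrI _)).
  by rewrite -[X in _ == X]addr0 (inj_eq (addrI _)) oneK_neq0.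
exists ((1 - eps r) *+ 2); rewrite hol_half hol_eps // mulr2n -addrA subrK.
by rewrite -[X in X == _]addr0 (inj_eq (addrI _)) eq_sym oneK_neq0.
Qed.

Let M_diff e f : M e -> M f -> [\/ f = e, f = e + w | e = f + w].
Proof.
move=> /orP[] /eqP-> /orP[] /eqP->; first
  [by constructor 1 | by constructor 2; rewrite addrC | by constructor 3; rewrite addrC].
Qed.

Let span f := exists i, f = s *+ i.

Let span_opp f : span f -> span (- f).
Proof.
case=> i ->; exists (i * a.-1)%N; apply/eqP; rewrite eq_sym -addr_eq0 -mulrnDr.
by rewrite s_ord -mulnSr prednK ?dvdn_mull // ltnW // ltnW.
Qed.

Let span_w : span w -> span 1.
Proof. by case=> i wi; exists i.+1; rewrite -sw mulrS -wi. Qed.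

(* Along a coset of <s>, the holonomy at a position of M is told from the other
   ones by agreeing somewhere with each of them, which two distinct
   translations never do. *)
Let M_shift e : M e -> M (e + j).
Proof.
move=> Me; apply/negPn/negP => nMej.
have eq_at i : exists v, hol (e + s *+ i + j) v = hol (e + j) v.
  have [v ev] := hol_common (e + s *+ i) Me; exists (sig e v).
  by apply/eqP; rewrite hol_shift ev.
(* If s generates Z/N, [eps] would be constant outside M, but it is 1 at 0 and - 1 at w. *)
have [/existsP[i /eqP s1]|] := boolP [exists i : 'I_a, 1 == s *+ i].
  have eps_eq f : ~~ M f -> eps f = eps (e + j).
    move=> nMf; pose d : 'Z_N := f - j - e; have [v] := eq_at (i * val d)%N.
    rewrite mulrnA -s1 Zp_val_natr (_ : e + d + j = f); last by rewrite /d; ring.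
    by rewrite !hol_eps // => /addrI.
  have := eps_eq _ nM0; rewrite -(eps_eq _ nMw) /eps !eqxx (negPf w0) => /eqP.
  rewrite -subr_eq0 opprK (Zp_nat_eq0 2) // => K2.
  by have := dvdn_leq (isT : (0 < 2)%N) K2; rewrite leqNgt K_gt2.
move=> /existsPn nspan1.
have nspan : ~ span 1.
  case=> i s1; have /negP := nspan1 (Ordinal (ltn_pmod i (ltnW (ltnW a_gt2)))); apply.
  rewrite /= {1}s1 {1}(divn_eq i a) mulrnDr mulnC mulrnA.
  by have /eqP-> : s *+ a == 0 by [rewrite s_ord]; rewrite mul0rn add0r.
(* Otherwise w is not in the span of s, so e + s and e + 2 s lie outside M. Their holonomies differ
   from that at e, which forces both shifted positions into M, although elements of M differ by 0 or
   by w up to sign. *)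
have nM i : (0 < i < 3)%N -> ~~ M (e + s *+ i).
  case/andP=> i_gt0 i_lt3; apply/negP => /(M_diff Me)[|/addrI wi|].
  - rewrite -[RHS]addr0 => /addrI/eqP; rewrite s_ord => a_i.
    by have := dvdn_leq i_gt0 a_i; rewrite leqNgt (leq_trans i_lt3).
  - by apply/nspan/span_w; exists i.
  - rewrite -addrA -[LHS]addr0 => /addrI/esym/eqP; rewrite addrC addr_eq0 => /eqP wi.
    by apply/nspan/span_w; rewrite wi; apply: span_opp; exists i.
have Mj i : (0 < i < 3)%N -> M (e + s *+ i + j).
  move=> i03; apply/negPn/negP => nMi.
  have [v ev] := hol_differ Me (nM i i03).
  have [v'] := eq_at i; rewrite !hol_eps // => /addrI eps_eq.
  by move: ev; rewrite eq_sym -hol_shift !hol_eps // eps_eq eqxx.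
have [||] := M_diff (Mj 1%N isT) (Mj 2%N isT).
- move/addIr/addrI/eqP; rewrite mulr2n -[X in _ == X]addr0 (inj_eq (addrI s)) -(mulr1n s).
  by rewrite s_ord dvdn1 gtn_eqF // ltnW.
- move=> E; apply/nspan/span_w; exists 1%N.
  by apply: (addrI (e + s *+ 1 + j)); rewrite -E; ring.
- move=> E; apply/nspan/span_w; rewrite (_ : w = - (s *+ 1)); first by apply: span_opp; exists 1%N.
  by apply: (addrI (e + s *+ 2 + j)); rewrite -E; ring.
Qed.

(** The shift j preserves {1, w + 1}, so j = 0, or j = w with 2 w = 0. *)
Lemma affine_symmetry : (w *+ 2 = 0 -> (3%:R : 'Z_K) != 0) -> u = 1%g.
Proof.
move=> K3; have M1 : M 1 by rewrite /M eqxx.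
have Mw1 : M (w + 1) by rewrite /M eqxx orbT.
have uE := symE sw ux uy affine_cover_full.
have sig2 v : sig (1 + 1) v = sig (w + 1) v.
  by rewrite -(sigDs (w + 1)); congr sig; rewrite -sw; ring.
have sig1 v : sig 1 v = sig w v by rewrite -(sigDs w) addrC sw.
case/orP: (M_shift M1) => /eqP j1.
  have j0 : j = 0 by apply: (addrI 1); rewrite j1 addr0.
  (* The holonomies 2 v at 1 and v - 1 at w agree exactly at v = - 1, and the image of this point
     satisfies the same equation. *)
  apply: (sym_fix_eq1 ux uy affine_cover_full (r := 1) (v := - 1)).
  rewrite uE -/j -/sig j0 addr0; congr (_, _).
  have e1 : sig (w + 1) (- 1 - 1) = sig 1 (- 1) + sig 1 (- 1).
    by have := sigD1 1 (- 1); rewrite j0 addr0 !hol1 sig2 !mulr2n.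
  have e2 : sig (w + 1) (- 1 - 1) = sig 1 (- 1) - 1.
    by have := sigD1 w (- 1); rewrite j0 addr0 !holw -sig1.
  by apply: (addrI (sig 1 (- 1))); rewrite -e1 e2.
have jw : j = w by apply: (addrI 1); rewrite j1 addrC.
have ww : w + w = 0.
  case/orP: (M_shift Mw1) => /eqP; rewrite jw => E.
    by apply: (subr_eq0P E); ring.
  by case/eqP: w0; apply: (subr_eq0P E); ring.
have sigS2 r v : sig (r + 2%:R) v = sig r v.
  rewrite -(sigDsn r 2); congr (sig (r + _)).
  by rewrite -sw -[RHS]addr0 -ww; ring.
have wN w' : w' + w = 0 -> w' = w by move=> w'w; apply: (addIr w); rewrite w'w ww.
(* If w = 2 then s = - 1; otherwise the holonomies at 2 and w + 2 are trivial. *)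
have sig10 v : sig 1 v = sig 0 v.
  have [w2|w2] := eqVneq w 2%:R.
    rewrite -(sigDs 1 v); congr sig.
    by rewrite -[s](addrK w) sw w2; ring.
  have n2 : (2%:R : 'Z_N) != 0.
    rewrite Zp_nat_eq0 //; apply/negP => N2.
    by have := dvdn_leq (isT : (0 < 2)%N) N2; rewrite leqNgt N_gt2.
  have <- : sig (2%:R + 1) v = sig 1 v by rewrite [2%:R + 1]addrC sigS2.
  have n21 : (2%:R : 'Z_N) != 1 by rewrite mulr2n -[X in _ == X]addr0 (inj_eq (addrI 1)).
  have n2w1 : (2%:R : 'Z_N) != w + 1 by rewrite mulr2n (inj_eq (addIr 1)) eq1w.
  have hol2 : hol 2%:R v = v by rewrite holD // eq_sym.
  have := sigD1 2%:R v; rewrite hol2 jw holD => [->||||].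
  - by rewrite -[2%:R]add0r sigS2.
  - by apply/eqP => /wN w2'; rewrite -w2' eqxx in w2.
  - by rewrite -[X in _ == X]add0r (inj_eq (addIr w)).
  - by apply/eqP => E; case/eqP: wN1; apply: (subr_eq0P E); ring.
  - by rewrite [w + 1]addrC (inj_eq (addIr w)).
(* The half turn exchanges v + 1 with v - 1 and 2 v with v / 2. So sig 0 is negation on 0, 1, 2,
   which is compatible with the second exchange only if 3 = 0. *)
have A v : sig 0 (v + 1) = sig 0 v - 1.
  by have := sigD1 0 v; rewrite jw !add0r hol0 holw sig10.
have B v : sig 0 (v *+ 2) *+ 2 = sig 0 v.
  have := sigD1 1 v; rewrite jw hol1 -[1 + 1]add0r (sigS2 0) [1 + w]addrC => ->.
  by rewrite holw1 sig10.
have a0 : sig 0 0 = 0.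
  by have := B 0; rewrite mul0rn mulr2n -[RHS]addr0 => /addrI.
have a1 : sig 0 1 = - 1 by rewrite -[X in sig 0 X]add0r A a0 sub0r.
have a2 : sig 0 (1 *+ 2) = - 1 - 1 by rewrite mulr2n A a1.
have /negP[] : (3%:R : 'Z_K) != 0 by apply: K3; rewrite mulr2n.
have := B 1; rewrite a2 a1 => E; apply/eqP; apply: (subr_eq0P (esym E)); ring.
Qed.
End AffineSymmetry.

End AffineCover.

(** * The threefold cover for b = 2 *)

Section InjectiveZ3.
Import GRing.Theory.
Local Open Scope ring_scope.

Lemma Zp3P (v : 'Z_3) : [\/ v = 0, v = 1 | v = 2%:R].
Proof.
by case: v => [[|[|[|]]] // ?]; [constructor 1|constructor 2|constructor 3]; apply: val_inj.
Qed.

(** The three distinct values of f sum to 0 in Z/3, so f 2 = 2 f 1 - f 0 and f is affine. *)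
Lemma inj_Zp3_affine (f : 'Z_3 -> 'Z_3) v v' :
  injective f -> f v - f v' = (f 1 - f 0) * (v - v').
Proof.
move=> f_inj; have fE x : f x = f 0 + (f 1 - f 0) * x.
  have f2 : f 2%:R = f 1 + f 1 - f 0.
    have : f 0 != f 1 by rewrite (inj_eq f_inj).
    have : f 0 != f 2%:R by rewrite (inj_eq f_inj).
    have : f 1 != f 2%:R by rewrite (inj_eq f_inj).
    by case: (Zp3P (f 0)) => ->; case: (Zp3P (f 1)) => ->; case: (Zp3P (f 2%:R)) => -> //;
       move=> *; apply: val_inj.
  case: (Zp3P x) => ->; rewrite ?f2; ring.
by rewrite (fE v) (fE v'); ring.
Qed.

End InjectiveZ3.

Section InvolutionCover.
Import GRing.Theory.
Local Open Scope ring_scope.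

Variables (N W : nat).
Hypotheses (W_gt3 : (3 < W)%N) (N_eq : N = (W + W)%N).

Let w : 'Z_N := W%:R.
Let s : 'Z_N := 1 + w.

Let N_gt1 : (1 < N)%N. Proof. by rewrite N_eq; lia. Qed.

Let ww : w + w = 0.
Proof. by apply/eqP; rewrite -natrD -N_eq Zp_nat_eq0. Qed.

Let sw : s + w = 1. Proof. by rewrite -addrA ww addr0. Qed.

Let s2 : s *+ 2 = 2%:R.
Proof. by rewrite mulr2n addrACA ww addr0. Qed.

Let reflI : injective (fun v : 'Z_3 => 1 - v).
Proof. by move=> v v' /addrI/oppr_inj. Qed.

Definition refl_perm (i : nat) : {perm 'Z_3} :=
  match i with
  | 0 => translation 1
  | 1 => perm (@oppr_inj 'Z_3)
  | 2 => perm reflI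
  | _ => 1%g
  end.

(** As w = W is an involution, the holonomy is [refl_perm i] at i < W and its inverse at i + W. The
    hypothesis W > 3 leaves a trivial position 3. *)
Definition refl_gauge (r : 'Z_N) : {perm 'Z_3} :=
  if (r < W)%N then 1%g else refl_perm (r - W).

Local Notation hol := (holonomy w refl_gauge).

Let val_nat i : (i < N)%N -> nat_of_ord (i%:R : 'Z_N) = i.
Proof. by move=> iN; rewrite val_Zp_nat // modn_small. Qed.

Let hol_lo i : (i < W)%N -> hol i%:R = refl_perm i.
Proof.
move=> iW; rewrite /holonomy /refl_gauge -natrD !val_nat ?N_eq; try lia.
by rewrite iW ltnNge leq_addl invg1 mul1g addnK.
Qed.

Let hol_hi i : (i < W)%N -> hol (i%:R + w) = ((refl_perm i)^-1)%g.
Proof.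
move=> iW; rewrite /holonomy /refl_gauge -addrA ww addr0 -natrD !val_nat ?N_eq; try lia.
by rewrite iW ltnNge leq_addl mulg1 addnK.
Qed.

Let Zp_split (r : 'Z_N) : exists2 i, (i < W)%N & r = i%:R \/ r = i%:R + w.
Proof.
have rN : (r < W + W)%N by rewrite -N_eq; apply: leq_trans (ltn_ord r) _; rewrite Zp_cast.
have [rW|Wr] := ltnP r W; first by exists r => //; left; rewrite Zp_val_natr.
exists (r - W)%N; first by rewrite ltn_subLR.
by right; rewrite -natrD subnK // Zp_val_natr.
Qed.

Let mult (i : nat) : 'Z_3 := if (i == 1%N) || (i == 2%N) then - 1 else 1.

Let refl_affine i v v' : refl_perm i v - refl_perm i v' = mult i * (v - v').
Proof.
case: i => [|[|[|i]]]; rewrite /mult /= ?perm1 ?permE; ring.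
Qed.

Let refl_affineV i v v' :
  ((refl_perm i)^-1)%g v - ((refl_perm i)^-1)%g v' = mult i * (v - v').
Proof.
rewrite -{2}[v](permKV (refl_perm i)) -{2}[v'](permKV (refl_perm i)) refl_affine mulrA.
by rewrite [mult i * _](_ : _ = 1) ?mul1r // /mult; case: ifP => _; ring.
Qed.

Let reflV i v : i = 1%N \/ i = 2%N -> ((refl_perm i)^-1)%g v = refl_perm i v.
Proof.
by move=> i12; apply: (canLR (permK _)); case: i12 => ->; rewrite /= !permE; ring.
Qed.

Let c := (@cover_black N 'Z_3 s * cover_white w refl_gauge)%g.

(** v + 1 and the two reflections compose to v + 2; their inverses, met in the same order, again
    lead back to v + 2. *)
Lemma refl_cover_turn v : (c ^+ N)%g (- s, v) = (- s, v + 2%:R).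
Proof.
pose f j := ((c ^+ j)%g (- s, v)).2.
have fst_c j : ((c ^+ j)%g (- s, v)).1 = - s + j%:R by rewrite (cover_face_fst _ sw).
have fS j : f j.+1 = hol j%:R (f j).
  rewrite /f expgSr permM; have := fst_c j; case: ((c ^+ j)%g _) => r v' /= ->.
  by rewrite (cover_faceE _ sw) /= addrAC addNr add0r.
have f0 : f 0%N = v by rewrite /f perm1.
have f1 : f 1%N = v + 1 by rewrite fS f0 hol_lo ?(ltn_trans _ W_gt3) // translationE.
have f2 : f 2%N = - (v + 1) by rewrite fS f1 hol_lo ?(ltn_trans _ W_gt3) // permE.
have f3 : f 3%N = v + 2%:R.
  by rewrite fS f2 hol_lo ?(ltn_trans _ W_gt3) // permE; ring.
have f_lo j : (2 < j <= W)%N -> f j = v + 2%:R.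
  elim: j => // j IHj /andP[j2 jW]; have [->//|j3] := eqVneq j 2%N.
  rewrite fS hol_lo // IHj; last by rewrite (ltnW jW) andbT ltn_neqAle eq_sym j3.
  by case: j j2 j3 {jW IHj} => [|[|[|j]]] // _ _; rewrite perm1.
have fW i : (i < W)%N -> f (i.+1 + W)%N = ((refl_perm i)^-1)%g (f (i + W)%N).
  by move=> iW; rewrite addSn fS natrD hol_hi.
have fW0 : f (0 + W)%N = v + 2%:R by rewrite f_lo // add0n leqnn (ltn_trans _ W_gt3).
have fW1 : f (1 + W)%N = v + 1.
  rewrite fW ?(ltn_trans _ W_gt3) // fW0; apply: (canLR (permK _)); rewrite translationE.
  by ring.
have fW2 : f (2 + W)%N = - (v + 1).
  by rewrite fW ?(ltn_trans _ W_gt3) // fW1 reflV; [rewrite permE|left].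
have fW3 : f (3 + W)%N = v + 2%:R.
  by rewrite fW ?(ltn_trans _ W_gt3) // fW2 reflV; [rewrite permE; ring|right].
have f_hi j : (2 < j <= W)%N -> f (j + W)%N = v + 2%:R.
  elim: j => // j IHj /andP[j2 jW]; have [->//|j3] := eqVneq j 2%N.
  rewrite fW // IHj; last by rewrite (ltnW jW) andbT ltn_neqAle eq_sym j3.
  by case: j j2 j3 {jW IHj} => [|[|[|j]]] // _ _; rewrite invg1 perm1.
rewrite [LHS]surjective_pairing fst_c -/(f N); congr (_, _).
  by rewrite (_ : N%:R = 0) ?addr0 //; apply/eqP; rewrite Zp_nat_eq0.
by rewrite N_eq f_hi // leqnn (ltn_trans _ W_gt3).
Qed.

Lemma refl_cover_full e : e \in porbit c (- s, 0).
Proof.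
apply: (cover_face_full sw N_gt1 (d := fun v => v + 2%:R)) => [|v].
  exact: refl_cover_turn.
exists (val v * 2)%N; rewrite -[RHS]Zp_val_natr; elim: (val v) => // i IHi.
have four_eq1 : (2%:R + 2%:R : 'Z_3) = 1 by apply: val_inj.
by rewrite mulSn iterD IHi /= -addrA four_eq1 -mulrSr.
Qed.

Section InvolutionSymmetry.
Variable u : {perm 'Z_N * 'Z_3}.
Hypotheses (ux : commute u (@cover_black N 'Z_3 s)).
Hypotheses (uy : commute u (cover_white w refl_gauge)).

Let j := sym_shift u (- s, 0).
Let sig := sym_fibre u.

Let sigD1 r v : sig (r + 1) (hol r v) = hol (r + j) (sig r v).
Proof. exact: (sym_fibreD1 sw ux uy refl_cover_full). Qed.

Let sigDsn r i v : sig (r + s *+ i) v = sig r v.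
Proof. exact: (sym_fibreDsn sw ux uy refl_cover_full). Qed.

Let sigD2 r v : sig (r + 2%:R) v = sig r v.
Proof. by rewrite -s2 sigDsn. Qed.

Let m (r : 'Z_N) := mult (r %% W).

Let hol_affine r v v' : hol r v - hol r v' = m r * (v - v').
Proof.
have W_N i : (i < W)%N -> (i < N)%N by rewrite N_eq => /leq_trans; apply; rewrite leq_addr.
rewrite /m; have [i iW [->|->]] := Zp_split r.
  by rewrite hol_lo // val_nat ?W_N // modn_small // refl_affine.
rewrite hol_hi // -natrD val_nat; last by rewrite N_eq ltn_add2r.
by rewrite modnDr modn_small // refl_affineV.
Qed.

(* The linear part of the affine map sig r. *)
Let B r := sig r 1 - sig r 0.

Let B_neq0 r : B r != 0.
Proof.
rewrite subr_eq0; apply/eqP => /(sym_fibre_inj sw ux uy refl_cover_full) /eqP.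
by [].
Qed.

Let B_sq r : B r * B r = 1.
Proof. by move: (B_neq0 r); case: (B r) => [[|[|[|]]]] // ? _; apply: val_inj. Qed.

Let sig_diff r v v' : sig r v - sig r v' = B r * (v - v').
Proof. exact/inj_Zp3_affine/(sym_fibre_inj sw ux uy refl_cover_full). Qed.

Let B_mult r : B (r + 1) * m r = m (r + j) * B r.
Proof.
have := hol_affine (r + j) (sig r 1) (sig r 0).
by rewrite -!sigD1 sig_diff hol_affine subr0 mulr1.
Qed.

(* B only depends on the parity of r, so it cancels in the product of two
   consecutive instances of B_mult. *)
Let mm_shift r : m r * m (r + 1) = m (r + j) * m (r + 1 + j).
Proof.
have B2 : B (r + 1 + 1) = B r by rewrite /B -addrA !sigD2.
rewrite -[LHS]mul1r -{1}(B_sq r).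
have e1 := B_mult r; have e2 := B_mult (r + 1); rewrite B2 in e2.
have -> : B r * B r * (m r * m (r + 1)) = B r * B r * (m r * m (r + 1)) * (B (r + 1) * B (r + 1)).
  by rewrite (B_sq (r + 1)) mulr1.
have -> : B r * B r * (m r * m (r + 1)) * (B (r + 1) * B (r + 1)) =
    B r * B (r + 1) * ((B (r + 1) * m r) * (B r * m (r + 1))) by ring.
rewrite e1 e2; have -> : B r * B (r + 1) * (m (r + j) * B r * (m (r + 1 + j) * B (r + 1))) =
   (B r * B r) * (B (r + 1) * B (r + 1)) * (m (r + j) * m (r + 1 + j)) by ring.
by rewrite !B_sq !mul1r.
Qed.

(** Modulo W, m is - 1 at 1 and 2 only, so m r * m (r + 1) is - 1 exactly at 0 and 2. For W > 4 only
    the zero shift preserves this pattern. *)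
Let j_eq : j = 0 \/ j = w.
Proof.
have [J JW j_J] := Zp_split j.
suff J0 : J = 0%N by move: j_J; rewrite J0 add0r.
have m_nat n : m n%:R = mult (n %% W).
  by rewrite /m val_Zp_nat // modn_dvdm // N_eq dvdn_add.
have m_shift i : m (i%:R + j) = mult ((i + J) %% W).
  by case: j_J => ->; rewrite -!natrD m_nat // addnA modnDr.
have mult1 : mult 1 = - 1 by [].
have mult2 : mult 2 = - 1 by [].
have multE i : (i != 1)%N -> (i != 2)%N -> mult i = 1.
  by rewrite /mult => /negPf-> /negPf->.
have one_neqN1 : (1 : 'Z_3) <> - 1 by move/eqP.
have [W_gt4|W_le4] := ltnP 4 W.
  have mm i : mult (i %% W) * mult (i.+1 %% W) = mult ((i + J) %% W) * mult ((i.+1 + J) %% W).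
    by have := mm_shift i%:R; rewrite -mulrSr !m_shift !m_nat.
  have W_i i : (i < 5)%N -> (i < W)%N by move=> i5; apply: leq_trans W_gt4.
  have := mm 0%N; have := mm 2%N.
  have sm i : (i < 5)%N -> (i %% W = i)%N by move=> /W_i; apply: modn_small.
  rewrite add0n add1n add2n add3n (sm 0%N) // (sm 1%N) // (sm 2%N) // (sm 3%N) //.
  rewrite mult1 mult2 (multE 0%N) // (multE 3%N) // mulr1 mul1r.
  rewrite (modn_small JW); case: J JW {j_J m_shift mm} => [//|[|[|J]]] JW.
  - by move=> _; rewrite (sm 2%N) // mult1 mult2 mulrNN mulr1 => /esym/one_neqN1.
  - rewrite (sm 4%N) // (multE 4%N) // mul1r => e5 _.
    case: one_neqN1; rewrite e5; apply/esym/multE.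
    + by have := W_gt4; rewrite leq_eqVlt => /orP[/eqP<-|W5]; rewrite ?modnn ?modn_small.
    + by have := W_gt4; rewrite leq_eqVlt => /orP[/eqP<-|W5]; rewrite ?modnn ?modn_small.
  - move=> _ e; case: one_neqN1; rewrite e (multE J.+3) // mul1r; apply/esym/multE.
    + by move: JW; rewrite leq_eqVlt => /orP[/eqP<-|J4]; rewrite ?modnn ?modn_small.
    + by move: JW; rewrite leq_eqVlt => /orP[/eqP<-|J4]; rewrite ?modnn ?modn_small.
have W4 : W = 4%N by apply/eqP; rewrite eqn_leq W_le4.
(* For W = 4 the pattern also allows a shift by 2. But 5 s = 1 in Z/8, so [sig] does not depend on r
   and m itself is preserved. *)
have B_const r : B (r + 1) = B r.
  have s5 : s *+ 5 = 1.
    have w4 : w = 4%:R by rewrite /w W4.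
    rewrite (mulrnDr s 4 1) (mulrnA s 2 2) s2 -[RHS]addr0 -ww {1}w4 /s; ring.
  by rewrite /B -{1 2}s5 !sigDsn.
have m_const i : mult (i %% W) = mult ((i + J) %% W).
  have := B_mult i%:R; rewrite B_const m_nat m_shift => e.
  by rewrite -[LHS]mul1r -(B_sq i%:R) -mulrA e mulrC -mulrA B_sq mulr1.
have := m_const 1%N; have := m_const 2%N; move: JW; rewrite W4.
by case: J {j_J m_shift m_const} => [|[|[|[|]]]] //= _; do 2?[move=> /eqP //].
Qed.

(** The reflections are involutions, so sig 0 commutes with both for either value of j and fixes
    their fixed points 0 and 2. For j = 0 this fixes an edge; for j = w it is incompatible with
    turning v + 1 into v - 1. *)
Lemma refl_symmetry : u = 1%g.
Proof.
have uE := symE sw ux uy refl_cover_full.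
have W_N i : (i < 4)%N -> (i < W)%N by move=> i4; apply: leq_trans W_gt3.
have hol_j i : (i < W)%N -> hol (i%:R + j) =1 refl_perm i \/ hol (i%:R + j) =1 (refl_perm i)^-1%g.
  move=> iW; case: j_eq => ->; [left|right] => v; first by rewrite addr0 hol_lo.
  by rewrite hol_hi.
have sig10 v : sig 1 v = sig 0 v.
  have := sigD1 3%:R v; rewrite hol_lo ?W_N // perm1.
  have -> : hol (3%:R + j) (sig 3%:R v) = sig 3%:R v.
    by case: (hol_j 3%N) => [|->|->]; rewrite ?W_N ?invg1 ?perm1.
  rewrite (_ : 3%:R + 1 = 0 + 2%:R + 2%:R); last by ring.
  by rewrite !sigD2 => ->.
have hol1j v : hol (1 + j) v = - v.
  by case: (hol_j 1%N) => [|->|->]; rewrite ?W_N // ?reflV ?permE //; left.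
have hol2j v : hol (2%:R + j) v = 1 - v.
  by case: (hol_j 2%N) => [|->|->]; rewrite ?W_N // ?reflV ?permE //; right.
have s1 v : sig 0 (- v) = - sig 0 v.
  have := sigD1 1 v; rewrite hol1j sig10 (hol_lo (i := 1%N)) ?W_N // permE.
  by rewrite -[1 + 1]add0r sigD2.
have s2' v : sig 0 (1 - v) = 1 - sig 0 v.
  have := sigD1 2%:R v; rewrite hol2j hol_lo ?W_N // permE.
  by rewrite addrC sigD2 sig10 -[2%:R]add0r sigD2.
have a0 : sig 0 0 = 0.
  by have := s1 0; rewrite oppr0; case: (Zp3P (sig 0 0)) => -> // /eqP.
case: j_eq => jE.
  by apply: (sym_fix_eq1 ux uy refl_cover_full (r := 0) (v := 0)); rewrite uE -/j jE -/sig a0 addr0.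
have a2 : sig 0 2%:R = 2%:R.
  have := s2' 2%:R; rewrite (_ : 1 - 2%:R = 2%:R); last by apply: val_inj.
  by case: (Zp3P (sig 0 2%:R)) => -> // /eqP.
have := sigD1 0 2%:R; rewrite jE add0r (hol_lo (i := 0%N)) ?W_N // translationE.
rewrite (_ : 2%:R + 1 = 0); last by apply: val_inj.
have := hol_hi (i := 0%N); rewrite add0r W_N // => /(_ isT) ->.
rewrite ?add0r sig10 a0 a2 => /(congr1 (refl_perm 0)).
by rewrite permKV translationE => /eqP.
Qed.

End InvolutionSymmetry.
End InvolutionCover.

(** * Passports realized by covers *)

Section CoverTriples.
Import GRing.Theory.
Local Open Scope ring_scope.

Lemma affine_triple N K p q a b s w :
  (2 < a)%N -> (1 < b)%N -> (1 < q)%N -> (2 < K)%N -> odd K -> (b = 2 -> K <> 3)%N ->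
  N = (p * a)%N -> N = (q * b)%N ->
  gcdn s N = p -> gcdn w N = q -> s + w = 1 %[mod N] ->
  asymmetric_triple (N * K) a b (N * K).
Proof.
move=> a_gt2 b_gt1 q_gt1 K_gt2 K_odd bK Npa Nqb sN wN sw.
have p_gt0 : (0 < p)%N by case: (p) Npa Nqb => //; rewrite mul0n => -> /eqP; rewrite eq_sym muln_eq0; lia.
have N_gt2 : (2 < N)%N by rewrite Npa (leq_trans a_gt2) // leq_pmull.
have N_gt1 := ltnW N_gt2; have K_gt1 := ltnW K_gt2.
have s_ord := Zp_mulrn_eq0 _ N_gt1 Npa sN.
have w_ord := Zp_mulrn_eq0 _ N_gt1 Nqb wN.
have sw1 := Zp_add_eq1 N_gt1 sw.
have w0 : (w%:R : 'Z_N) != 0 by rewrite -[X in X != _]mulr1n w_ord dvdn1 gtn_eqF.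
have w1 : (w%:R : 'Z_N) != 1.
  apply/eqP => w1; have := s_ord 1%N; rewrite dvdn1 gtn_eqF ?(ltnW a_gt2) // mulr1n.
  by move: sw1; rewrite w1 -[RHS]add0r => /addIr->; rewrite eqxx.
(* - 1 has order N, whereas w has order b < N. *)
have wN1 : (w%:R : 'Z_N) + 1 != 0.
  rewrite addr_eq0; apply/eqP => wN1; have := w_ord b; rewrite dvdnn wN1 mulNrn oppr_eq0.
  rewrite Zp_nat_eq0 // => /(dvdn_leq (ltnW b_gt1)).
  by rewrite leqNgt Nqb ltn_Pmull // ltnW.
have xa : uniform_cycles (cover_black 'Z_K (s%:R : 'Z_N)) a.
  by apply: skew_cycles s_ord; rewrite ltnW // ltnW.
have yb : uniform_cycles (cover_white (w%:R : 'Z_N) (@affine_gauge N K w%:R K_gt2 K_odd)) b.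
  by apply: cover_white_cycles w_ord; rewrite ltnW.
have full := @affine_cover_full N K _ _ N_gt2 K_gt2 K_odd sw1 w0 w1 wN1.
have := asymmetric_triple_of_cycle xa yb full.
suff asym : asymmetric (cover_black 'Z_K (s%:R : 'Z_N))
    (cover_white (w%:R : 'Z_N) (@affine_gauge N K w%:R K_gt2 K_odd)).
  by move/(_ asym); rewrite card_prod !card_ord !Zp_cast.
move=> u ux uy.
apply: (affine_symmetry N_gt2 sw1 w0 w1 wN1 a_gt2 s_ord ux uy).
move=> /eqP; rewrite w_ord => b2; rewrite Zp_nat_eq0 //.
have b_eq : b = 2%N by apply/eqP; rewrite eqn_leq b_gt1 dvdn_leq.
apply/negP => K3; apply: (bK b_eq).
by apply/eqP; rewrite eqn_leq K_gt2 dvdn_leq.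
Qed.

Lemma involution_triple N p q a s w :
  (3 < q)%N -> N = (p * a)%N -> N = (q * 2)%N ->
  gcdn s N = p -> gcdn w N = q -> s + w = 1 %[mod N] ->
  asymmetric_triple (N * 3) a 2 (N * 3).
Proof.
move=> q_gt3 Npa Nq2 sN wN sw.
have N_gt1 : (1 < N)%N by rewrite Nq2; lia.
have q_gt0 : (0 < q)%N by apply: leq_trans q_gt3.
have Nqq : N = (q + q)%N by rewrite Nq2 muln2 addnn.
have s_ord := Zp_mulrn_eq0 _ N_gt1 Npa sN.
have w_ord := Zp_mulrn_eq0 _ N_gt1 Nq2 wN.
have sw1 := Zp_add_eq1 N_gt1 sw.
have a_gt0 : (0 < a)%N by case: (a) Npa N_gt1 => //; rewrite muln0 => ->.
(* w is an odd multiple of q = N / 2. *)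
have wq : (w%:R : 'Z_N) = q%:R.
  have /dvdnP[w' w_eq] : (q %| w)%N by rewrite -wN dvdn_gcdl.
  have w'_odd : odd w'.
    apply/negPn/negP => w'_even; have := w_ord 1%N; rewrite mulr1n Zp_nat_eq0 //.
    by rewrite w_eq Nq2 [(q * 2)%N]mulnC dvdn_pmul2r // !dvdn2 w'_even.
  rewrite w_eq -[w']odd_double_half w'_odd mulnDl mul1n natrD -muln2 -mulnA mulnC [(2 * q)%N]mulnC -Nq2 natrM.
  have -> : (N%:R : 'Z_N) = 0 by apply/eqP; rewrite Zp_nat_eq0.
  by rewrite mul0r addr0.
have qq0 : (q%:R : 'Z_N) + q%:R = 0 by apply/eqP; rewrite -natrD -Nqq Zp_nat_eq0.
have sq : (s%:R : 'Z_N) = 1 + q%:R.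
  by apply: (addIr w%:R); rewrite sw1 wq -addrA qq0 addr0.
rewrite sq in s_ord; rewrite wq in w_ord.
have xa : uniform_cycles (cover_black 'Z_3 (1 + q%:R : 'Z_N)) a by apply: skew_cycles s_ord.
have yb : uniform_cycles (cover_white (q%:R : 'Z_N) (@refl_gauge N q)) 2.
  exact: cover_white_cycles w_ord.
have := asymmetric_triple_of_cycle xa yb (refl_cover_full q_gt3 Nqq).
suff asym : asymmetric (cover_black 'Z_3 (1 + q%:R : 'Z_N))
    (cover_white (q%:R : 'Z_N) (@refl_gauge N q)).
  by move/(_ asym); rewrite card_prod !card_ord !Zp_cast.
move=> u ux uy; exact: refl_symmetry ux uy.
Qed.

End CoverTriples.

(** * Four exceptional passports *)

Section Tables.
Local Open Scope group_scope.

Variables (n a b : nat) (xs ys : seq nat).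
Local Notation tab s := (nth 0 s).

Definition table_cycles (s : seq nat) (l : nat) :=
  all (fun e => (iter l (tab s) e == e) &&
    all (fun i => iter i.+1 (tab s) e != e) (iota 0 l.-1)) (iota 0 n).

(** The edges are numbered along the face, so [x * y] is e -> e + 1 and only shifts commute with it;
    the last test rules out every nonzero shift. *)
Definition asymmetric_table :=
  [&& (size xs == n) && (size ys == n), uniq xs && uniq ys,
      all (gtn n) xs && all (gtn n) ys,
      table_cycles xs a && table_cycles ys b,
      all (fun e => tab ys (tab xs e) == e.+1 %% n) (iota 0 n)
    & all (fun d => has (fun e => tab xs ((e + d.+1) %% n) != (tab xs e + d.+1) %% n)
        (iota 0 n)) (iota 0 n.-1)].

Lemma table_triple :
  0 < n -> 0 < a -> 0 < b -> asymmetric_table -> asymmetric_triple n a b n.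
Proof.
move=> n_gt0 a_gt0 b_gt0 /and5P[/andP[/eqP sx /eqP sy] /andP[ux uy] /andP[lx ly] /andP[cx cy]].
case/andP=> /allP fxy /allP asym.
have tab_lt s (e : 'I_n) : size s = n -> all (gtn n) s -> tab s e < n.
  by move=> ss /allP; apply; rewrite mem_nth // ss.
pose fx (e : 'I_n) := Ordinal (tab_lt xs e sx lx); pose fy (e : 'I_n) := Ordinal (tab_lt ys e sy ly).
have fx_inj : injective fx.
  by move=> e e' /(congr1 val)/eqP; rewrite /= nth_uniq ?sx // => /eqP/val_inj.
have fy_inj : injective fy.
  by move=> e e' /(congr1 val)/eqP; rewrite /= nth_uniq ?sy // => /eqP/val_inj.
pose x := perm fx_inj; pose y := perm fy_inj.
have xE e : val (x e) = tab xs e by rewrite permE.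
have yE e : val (y e) = tab ys e by rewrite permE.
have cyc s (p : {perm 'I_n}) l : (forall e, val (p e) = tab s e) -> 0 < l ->
    table_cycles s l -> uniform_cycles p l.
  move=> pE l_gt0 /allP sl.
  have pX i e : val ((p ^+ i) e) = iter i (tab s) e.
    by elim: i => [|i IHi]; rewrite ?perm1 // expgSr permM pE IHi.
  have e_in (e : 'I_n) : val e \in iota 0 n by rewrite mem_iota ltn_ord.
  apply: uniform_cyclesP => // e => [[|i] il|].
  - by rewrite perm1 eqxx.
  - have /andP[_ /allP min_e] := sl _ (e_in e).
    by rewrite -val_eqE pX; apply/negbTE/min_e; rewrite mem_iota; lia.
  - by apply: val_inj; have /andP[/eqP el _] := sl _ (e_in e); rewrite pX.
pose e0 := Ordinal n_gt0.
have cE e : val ((x * y) e) = e.+1 %% n.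
  by rewrite permM yE xE; apply/eqP/fxy; rewrite mem_iota ltn_ord.
have cX i e : val (((x * y) ^+ i) e) = (e + i) %% n.
  elim: i => [|i IHi]; first by rewrite perm1 addn0 modn_small.
  by rewrite expgSr permM cE IHi -addn1 modnDml addn1 addnS.
have c0 (e : 'I_n) : e = ((x * y) ^+ e) e0 by apply: val_inj; rewrite cX add0n modn_small.
rewrite -[X in asymmetric_triple X _ _ _]card_ord -[X in asymmetric_triple _ _ _ X]card_ord.
apply: (@asymmetric_triple_of_cycle _ x y _ _ e0).
- exact: cyc cx.
- exact: cyc cy.
- by move=> e; rewrite [e]c0 mem_porbit.
move=> u cux cuy.
have uE e : val (u e) = (e + u e0) %% n.
  rewrite {1}[e]c0 -permM -(commuteX e (commuteM cux cuy)) permM cX addnC.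
  by rewrite /=.
case d_eq: (val (u e0)) => [|d].
  by apply/permP => e; apply: val_inj; rewrite uE d_eq addn0 modn_small // perm1.
have d_lt : d.+1 < n by rewrite -d_eq; apply: ltn_ord.
have /asym/hasP[e] : d \in iota 0 n.-1 by rewrite mem_iota /= -ltnS prednK.
rewrite mem_iota /= => e_lt /eqP[]; pose E := Ordinal e_lt.
have : val (u (x E)) = val (x (u E)) by rewrite -!permM cux.
by rewrite xE (uE (x E)) (uE E) xE d_eq.
Qed.
End Tables.

Lemma triple_10_5_2 : asymmetric_triple 10 5 2 10.
Proof.
by apply: (@table_triple 10 5 2
  [:: 6; 8; 5; 0; 3; 1; 9; 2; 7; 4]
  [:: 4; 6; 8; 5; 0; 3; 1; 9; 2; 7]).
Qed.

Lemma triple_12_4_2 : asymmetric_triple 12 4 2 12.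
Proof.
by apply: (@table_triple 12 4 2
  [:: 4; 9; 6; 1; 10; 3; 11; 0; 2; 5; 7; 8]
  [:: 8; 4; 9; 6; 1; 10; 3; 11; 0; 2; 5; 7]).
Qed.

Lemma triple_12_4_3 : asymmetric_triple 12 4 3 12.
Proof.
by apply: (@table_triple 12 4 3
  [:: 9; 0; 11; 10; 3; 4; 1; 2; 7; 6; 5; 8]
  [:: 2; 7; 8; 5; 6; 11; 10; 9; 0; 1; 4; 3]).
Qed.

Lemma triple_18_3_2 : asymmetric_triple 18 3 2 18.
Proof.
by apply: (@table_triple 18 3 2
  [:: 13; 7; 14; 0; 10; 15; 2; 12; 16; 5; 17; 8; 1; 3; 6; 9; 11; 4]
  [:: 4; 13; 7; 14; 0; 10; 15; 2; 12; 16; 5; 17; 8; 1; 3; 6; 9; 11]).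
Qed.

(** * From passports to asymmetric pairs of rotations *)

Lemma perm_eq3 (T : eqType) (x y z u v w : T) :
  perm_eq [:: x; y; z] [:: u; v; w] ->
  [\/ [:: x; y; z] = [:: u; v; w], [:: x; y; z] = [:: u; w; v],
      [:: x; y; z] = [:: v; u; w]
    | [\/ [:: x; y; z] = [:: v; w; u], [:: x; y; z] = [:: w; u; v]
        | [:: x; y; z] = [:: w; v; u]]].
Proof.
have perm2 (s t s' t' : T) : perm_eq [:: s; t] [:: s'; t'] ->
    [:: s; t] = [:: s'; t'] \/ [:: s; t] = [:: t'; s'].
  move=> st; have := perm_mem st s; rewrite !inE eqxx /= => /esym/orP[] /eqP es.
    by move: st; rewrite es perm_cons => /perm_small_eq->; [left|].
  move: st; rewrite es (perm_sym _ [:: s'; t']) (perm_catCA [:: s'] [:: t'] [::]) /=.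
  by rewrite perm_cons perm_sym => /perm_small_eq->; [right|].
move=> xyz; have := perm_mem xyz x; rewrite !inE eqxx /= => /esym/or3P[] /eqP ex.
- by move: xyz; rewrite ex perm_cons => /perm2[] [-> ->]; [constructor 1|constructor 2].
- move: xyz; rewrite ex (perm_sym _ [:: u; v; w]) (perm_catCA [:: u] [:: v] [:: w]) /=.
  by rewrite perm_cons perm_sym => /perm2[] [-> ->]; [constructor 3|constructor 4; constructor 1].
- move: xyz; rewrite ex (perm_sym _ [:: u; v; w]) (perm_catCA [:: u; v] [:: w] [::]) /=.
  by rewrite perm_cons perm_sym => /perm2[] [-> ->]; constructor 4; [constructor 2|constructor 3].
Qed.

(** The swap and the rotation of a triple generate all six orders of the entries. *)
Lemma passport_permutations n a b p q (P : passport) :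
  0 < n -> n = (p * a)%N -> n = (q * b)%N -> asymmetric_triple n a b n ->
  perm_eq P (uniform_passport a p b q n 1) ->
  exists D : dessin, passport_of D = P /\ automorphism_group D = 1%G.
Proof.
move=> n_gt0 npa nqb abn.
have n1n : n = (1 * n)%N by rewrite mul1n.
have ban := asymmetric_triple_swap abn.
have bna := asymmetric_triple_rot abn; have nba := asymmetric_triple_swap bna.
have anb := asymmetric_triple_rot ban; have nab := asymmetric_triple_swap anb.
case: P => [[|A [|B [|C []]]]] //= szP /perm_eq3 P_eq.
suff [D [D_eq D1]] : exists D : dessin,
    val (passport_of D) = [:: A; B; C] /\ automorphism_group D = 1%G.
  by exists D; split=> //; apply: val_inj.
by case: P_eq => [|||[]] ->;
   [have [D [DP D1]] := asymmetric_triple_dessin n_gt0 npa nqb n1n abn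
   |have [D [DP D1]] := asymmetric_triple_dessin n_gt0 npa n1n nqb anb
   |have [D [DP D1]] := asymmetric_triple_dessin n_gt0 nqb npa n1n ban
   |have [D [DP D1]] := asymmetric_triple_dessin n_gt0 nqb n1n npa bna
   |have [D [DP D1]] := asymmetric_triple_dessin n_gt0 n1n npa nqb nab
   |have [D [DP D1]] := asymmetric_triple_dessin n_gt0 n1n nqb npa nba];
   exists D; rewrite DP.
Qed.

(** * Arithmetic of the genus *)

Section Genus.
Import Order.TTheory GRing.Theory Num.Theory.

(** n = p + q + 1 + (2 g - 2) with g an integer and g >= 2. *)
Lemma genus_ge2P a b p q n :
  n = p * a ->
  genus (uniform_passport a p b q n 1) \is a Num.int ->
  (2%:R <= genus (uniform_passport a p b q n 1))%R ->
  odd (n + p + q) /\ p + q + 3 <= n.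
Proof.
move=> npa; rewrite /genus /= !big_cons big_nil /= !size_nseq.
have -> : sumn (nseq p a) = n by rewrite npa sumn_nseq mulnC.
set m := p + (q + _); move=> /intrP[i i_eq]; rewrite i_eq (ler_int _ 2).
have ni : (n%:Z = m%:Z + (i * 2 - 2))%R.
  apply/eqP; rewrite -(eqr_int rat) rmorphD rmorphB rmorphM /= -i_eq -!pmulrn.
  by apply/eqP; field.
by move=> i2; rewrite /m in ni; lia.
Qed.

End Genus.

Lemma uniform_triple a b p q n :
  n = (p * a)%N -> n = (q * b)%N -> (1 < p)%N -> (p < q)%N ->
  odd (n + p + q) -> (p + q + 3 <= n)%N -> asymmetric_triple n a b n.
Proof.
move=> npa nqb p_gt1 ltpq odd_n genus_n.
have n_gt0 : (0 < n)%N by lia.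
have [co_pq|nco_pq] := boolP (coprime p q).
  have [/eqP[q5 b2]|qb52] := boolP ((q, b) == (5, 2)%N).
    have n10 : n = 10 by rewrite nqb q5 b2.
    have p2 : p = 2%N.
      move: p_gt1 ltpq npa; rewrite q5 n10; case: (p) => [|[|[|[|[|]]]]] // _ _; lia.
    have a5 : a = 5 by move: npa; rewrite n10 p2; lia.
    by rewrite a5 b2 n10; apply: triple_10_5_2.
  have [/eqP[q4 b3]|qb43] := boolP ((q, b) == (4, 3)%N).
    have n12 : n = 12 by rewrite nqb q4 b3.
    have p3 : p = 3%N.
      by move: p_gt1 ltpq co_pq; rewrite q4; case: (p) => [|[|[|[|]]]].
    have a4 : a = 4%N by move: npa; rewrite n12 p3; lia.
    by rewrite a4 b3 n12; apply: triple_12_4_3.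
  exact: coprime_triple npa nqb co_pq p_gt1 ltpq odd_n genus_n qb52 qb43.
set K := gcdn p q in nco_pq.
have p_gt0 := ltnW p_gt1.
have K_gt0 : (0 < K)%N by rewrite gcdn_gt0 p_gt0.
have /dvdnP[p0 p_eq] : K %| p by apply: dvdn_gcdl.
have /dvdnP[q0 q_eq] : K %| q by apply: dvdn_gcdr.
have co_pq0 : coprime p0 q0.
  have := erefl K; rewrite {1}/K p_eq q_eq -muln_gcdl -{2}(mul1n K) => /eqP.
  by rewrite eqn_pmul2r.
pose N := (p0 * a)%N.
have nNK : n = (N * K)%N by rewrite npa p_eq /N; ring.
have Nqb : N = (q0 * b)%N.
  apply/eqP; rewrite -(@eqn_pmul2r K) // -nNK nqb q_eq; apply/eqP; ring.
(* n + p + q = K (N + p0 + q0) is odd. *)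
have oddKN : odd K && odd (N + p0 + q0) by rewrite -oddM mulnC !mulnDl -nNK -p_eq -q_eq.
have [K_odd N_odd] := andP oddKN.
have K_gt2 : (2 < K)%N by move: nco_pq K_odd K_gt0; rewrite /coprime -/K; case: (K) => [|[|[|]]].
have p0_gt0 : (0 < p0)%N by move: p_gt0; rewrite p_eq muln_gt0 => /andP[].
have ltpq0 : (p0 < q0)%N by move: ltpq; rewrite p_eq q_eq ltn_pmul2r.
have q_gt0 : (0 < q)%N by apply: leq_trans ltpq.
have b_gt1 : (1 < b)%N.
  move: genus_n; rewrite nqb; case: (b) => [|[|]] //; first by rewrite muln0; lia.
  by rewrite muln1; lia.
have ltba : (b < a)%N.
  rewrite -(@ltn_pmul2l p) // -npa nqb ltn_pmul2r // ltnW //.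
have a_gt2 : (2 < a)%N by apply: leq_ltn_trans ltba.
have N_gt0 : (0 < N)%N by move: n_gt0; rewrite nNK muln_gt0 => /andP[].
have [||s [w [sN wN sw]]] := exists_rotations N_gt0 _ _ co_pq0 N_odd.
- by rewrite dvdn_mulr.
- by rewrite Nqb dvdn_mulr.
have q0_gt1 : (1 < q0)%N by apply: leq_ltn_trans ltpq0.
have [/andP[/eqP b2 /eqP K3]|bK] := boolP ((b == 2) && (K == 3))%N; last first.
  rewrite nNK; apply: affine_triple sN wN sw => // b2 K3.
  by move: bK; rewrite b2 K3.
rewrite nNK K3 b2 in Nqb *.
(* For q0 <= 3, p0 a = 2 q0 and the parity of N + p0 + q0 leave only the tables with 12 and 18
   edges. *)
have [q0_gt3|q0_le3] := ltnP 3 q0; first exact: involution_triple sN wN sw.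
have pa : (p0 * a = q0 * 2)%N by [].
have [q02|q02] := eqVneq q0 2%N.
  have p01 : p0 = 1%N by lia.
  have a4 : a = 4%N by move: pa; rewrite p01 q02; lia.
  by rewrite /N p01 a4; apply: triple_12_4_2.
have q03 : q0 = 3%N by lia.
have p02 : p0 = 2%N.
  move: N_odd; rewrite Nqb q03; have : (p0 < 3)%N by rewrite -q03.
  by case: (p0) p0_gt0 => [|[|[|]]].
have a3 : a = 3%N by move: pa; rewrite p02 q03; lia.
by rewrite /N p02 a3; apply: triple_18_3_2.
Qed.

Theorem theorem5p1 (a b p q n : nat)
    (ha : 0 < a) (hb : 0 < b) (hp : 0 < p) (hq : 0 < q) (hn : 0 < n)
    (hpa : n = p * a) (hqb : n = q * b) (hp2 : 2 <= p) (hpq : p < q)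
    (hgint : genus (uniform_passport a p b q n 1) \is a Num.int)
    (hg2 : (2%:R <= genus (uniform_passport a p b q n 1))%R)
    (P : passport) (hP : perm_eq P (uniform_passport a p b q n 1)) :
  exists D : dessin,
    passport_of D = P /\ automorphism_group D = 1%G.
Proof.
have [odd_n genus_n] := genus_ge2P hpa hgint hg2.
have abn := uniform_triple hpa hqb hp2 hpq odd_n genus_n.
exact: (passport_permutations hn hpa hqb abn hP).
Qed.
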